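(* Let $q<-1$ be a negative real number. (a) If $q=-\frac{1+\sqrt5}{2}$, then the set of expansions of $x=0$ in base $q$ is countably infinite. (b) If $-\frac{1+\sqrt5}{2}<q<-1$, then each interior point of $J_q$ (interior taken in $\mathbb R$) has continuum many expansions in base $q$. (c) If $-\sqrt[4]{2}<q<-1$ and $q^2$ is different from the second Pisot number, then each interior point of $J_q$ has a universal expansion in base $q$.
   Context: For a real or complex number $q$ with $|q|>1$, an expansion of a number $x$ in base $q$ is a sequence $(c_k)_{k\ge1}$ with $c_k\in\{0,1\}$ such that $\sum_{k=1}^\infty c_k q^{-k}=x$. $J_q$ denotes the set of all numbers having at least one expansion in base $q$. An expansion is universal if the sequence $(c_k)$ contains every finite block of zeroes and ones as a block of consecutive terms. The second Pisot number is the second smallest Pisot number, $\approx 1.3803$, the real root greater than $1$ of $x^4-x^3-1$. *)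

(* Defs.v *)
From mathcomp Require Import all_boot all_order all_algebra.
From mathcomp Require Import complex.
From mathcomp Require Import all_classical all_reals all_analysis.
Set Implicit Arguments.
Unset Strict Implicit.
Unset Printing Implicit Defensive.
Import Order.TTheory GRing.Theory Num.Theory.
Import numFieldNormedType.Exports.
Local Open Scope classical_set_scope.
Local Open Scope ring_scope.

(* Digits are indexed from 0: [c k] is the coefficient of [q ^- k.+1]. *)
Definition expansions (R : realType) (q x : R) : set (nat -> bool) :=
  [set c : nat -> bool | series (fun k => (c k)%:R * q ^- k.+1) @ \oo --> x].

Definition J (R : realType) (q : R) : set R :=
  [set x | exists c, expansions q x c].

Definition universal (c : nat -> bool) : Prop :=
  forall w : seq bool, exists n, mkseq (fun i => c (n + i)%N) (size w) = w.

(* [p] is the minimal polynomial of [t] over Q (with integer coefficients, as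
   [t] is an algebraic integer), so its complex roots are the conjugates. *)
Definition pisot (R : realType) (t : R) : Prop :=
  1 < t /\
  exists p : {poly int},
    [/\ p \is monic,
        irreducible_poly (map_poly intr p : {poly rat}),
        root (map_poly intr p) t &
        forall z : complex R, root (map_poly intr p) z ->
          z <> real_complex R t -> `|z| < 1].

Definition second_pisot (R : realType) (t : R) : Prop :=
  pisot t /\ exists! s : R, pisot s /\ s < t.

(* Main.v *)
Require Import Defs.
From mathcomp Require Import all_boot all_order all_algebra.
From mathcomp Require Import complex ring lra zify.
From mathcomp Require Import all_classical all_reals all_analysis.
Set Implicit Arguments.
Unset Strict Implicit.
Unset Printing Implicit Defensive.
Import Order.TTheory GRing.Theory Num.Theory.
Import numFieldNormedType.Exports.
Local Open Scope classical_set_scope.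
Local Open Scope ring_scope.

(* Negating the digits of even index turns base [q < -1] into base [p = -q] and
   translates the expanded number by [p / (p^2 - 1)].  An expansion of [x] in base [p]
   is an orbit [r |-> p r - d] of [x] that stays in [[0, 1/(p-1)]].

   (a), (b): at the golden ratio the orbits of 1 live on four points and leave the
   cycle 1010... at most once; below it every interior orbit meets infinitely often the
   region where both digits are allowed.

   (c) holds for every [p] with [p^4 < 2], whether or not [p^2] is a Pisot number.
   The positions [3 mod 4] suffice to approximate any positive number, so it is enough
   that the sums over the remaining positions have arbitrarily small nonzero
   differences.  Otherwise these sums are uniformly separated; a window with the maximal
   number of them shows that their bounded differences form a finite set, and trading
   residues mod 4 against each other extends this to the values at [p] of all integer
   polynomials of any bounded height.  This forces all conjugates of [p] into the open
   unit disc.  But then [p] is a Pisot number below 5/4, which is excluded by Siegel's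
   method: writing [mu'] for the reciprocal of the minimal polynomial [mu], the quotient
   [mu / mu'] is, up to the factor [(X - p) / (1 - p X)], a Blaschke product with integer
   Taylor coefficients. *)

(** * Blaschke contraction and small Pisot numbers *)

Section TruncatedPolynomials.
Variable K : comNzRingType.
Implicit Types p q r A B : {poly K}.

(** Congruence modulo [X^N]: polynomials stand for power series truncated at order [N], so that
    division by a series with constant term 1 makes sense. *)
Definition eqX N p q := forall i, (i < N)%N -> p`_i = q`_i.

Lemma eqX_sym N p q : eqX N p q -> eqX N q p.
Proof. by move=> e i iN; rewrite e. Qed.

Lemma eqX_trans N q p r : eqX N p q -> eqX N q r -> eqX N p r.
Proof. by move=> e f i iN; rewrite e // f. Qed.

Lemma eqX_mull N r p q : eqX N p q -> eqX N (r * p) (r * q).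
Proof.
move=> e i iN; rewrite !coefM; apply: eq_bigr => j _.
by rewrite e // (leq_ltn_trans (leq_subr _ _)).
Qed.

(** Power series division: the coefficient of [u] in degree [N] is chosen to cancel the error left
    there, which works because [A] has constant term 1. *)
Lemma eqX_div A B N : A`_0 = 1 -> exists u, eqX N (A * u) B.
Proof.
move=> A0; elim: N => [|N [u hu]]; first by exists 0.
exists (u + (B`_N - (A * u)`_N)%:P * 'X^N) => i; rewrite ltnS leq_eqVlt.
rewrite mulrDr coefD mulrCA coefCM coefMXn => /predU1P[->|iN].
  by rewrite ltnn subnn A0 mulr1 addrC subrK.
by rewrite iN mulr0 addr0 hu.
Qed.

Lemma eqX_mulI A p q N : A`_0 = 1 -> eqX N (A * p) (A * q) -> eqX N p q.
Proof.
move=> A0 e; have [A' hA'] := eqX_div 1 N A0.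
have inv r : eqX N r (A' * (A * r)).
  have := eqX_mull r hA'; rewrite mulr1 => /eqX_sym h.
  by rewrite mulrA [A' * A]mulrC [A * A' * r]mulrC.
apply: eqX_trans (inv p) _; apply: eqX_trans (eqX_sym (inv q)).
exact: eqX_mull.
Qed.

(** The reciprocal polynomial [X^n p(1/X)] for [p] of degree at most [n]. The explicit [n] grows by
    one with each linear factor. *)
Definition revpoly n p := \poly_(i < n.+1) p`_(n - i).

Lemma revpoly_mulXsubC n p a : (size p <= n.+1)%N ->
  revpoly n.+1 (('X - a%:P) * p) = (1 - a *: 'X) * revpoly n p.
Proof.
move=> sp; apply/polyP => i.
rewrite coef_poly [(1 - _) * _]mulrBl mul1r coefB -scalerAl coefZ coefXM !coef_poly.
rewrite mulrBl coefB coefXM coefCM.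
have [->|i0] := eqVneq i 0%N; first by rewrite !subn0 /= (nth_default _ sp) !mulr0.
case: (ltnP i n.+2) => hi; last first.
  by rewrite !ifN ?subrr ?mulr0 ?subr0 // -?leqNgt //; lia.
rewrite (_ : (i.-1 < n.+1)%N); last lia.
rewrite (_ : (n - i.-1 = n.+1 - i)%N); last lia.
congr (_ - _); case: (ltnP i n.+1) => hj; last by rewrite (_ : (n.+1 - i = 0)%N) //; lia.
by rewrite subSn ?ltnS //.
Qed.

Lemma revpoly_prod (s : seq K) :
  revpoly (size s) (\prod_(a <- s) ('X - a%:P)) = \prod_(a <- s) (1 - a *: 'X).
Proof.
elim: s => [|a s IH]; first by rewrite !big_nil /revpoly poly_def big_ord1 coef1 expr0 scale1r.
by rewrite !big_cons revpoly_mulXsubC ?IH // size_prod_XsubC.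
Qed.

End TruncatedPolynomials.

Lemma revpoly_map (K L : comNzRingType) (f : {rmorphism K -> L}) n (p : {poly K}) :
  revpoly n (map_poly f p) = map_poly f (revpoly n p).
Proof.
apply/polyP => i; rewrite coef_map [LHS]coef_poly [(revpoly _ _)`__]coef_poly.
by rewrite coef_map; case: ifP => _ //; exact: (esym (rmorph0 f)).
Qed.

Section Pisot.
Variable R : rcfType.
Local Notation C := R[i].
Implicit Types (a z : C) (h k : {poly C}).

(** The squared modulus with values in [R], where [|z|] would lie in [R[i]]. *)
Definition sqnorm z : R := complex.Re z ^+ 2 + complex.Im z ^+ 2.

Lemma sqnorm_ge0 z : 0 <= sqnorm z.
Proof. by rewrite addr_ge0 ?sqr_ge0. Qed.

Lemma sqnormM z z' : sqnorm (z * z') = sqnorm z * sqnorm z'.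
Proof. by case: z => a b; case: z' => c d; rewrite /sqnorm /=; ring. Qed.

Lemma sqnormN z : sqnorm (- z) = sqnorm z.
Proof. by case: z => a b; rewrite /sqnorm /= !sqrrN. Qed.

Lemma sqnorm_real (x : R) : sqnorm x%:C%C = x ^+ 2.
Proof. by rewrite /sqnorm /= expr0n addr0. Qed.

Lemma sqnorm_prod (s : seq C) (f : C -> C) :
  sqnorm (\prod_(a <- s) f a) = \prod_(a <- s) sqnorm (f a).
Proof.
apply: (big_morph sqnorm sqnormM).
by rewrite /sqnorm /= expr1n expr0n addr0.
Qed.

(** For [|a| < 1], multiplication by the Blaschke factor [(X - a) / (1 - conj(a) X)] preserves the
    sum of squared moduli of the coefficients of a full series; the formula measures what truncation
    after degree [N] loses. *)
Lemma blaschke_factor_defect a h k N : eqX N.+1 ((1 - conjc a *: 'X) * k) (('X - a%:P) * h) ->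
  (1 - sqnorm a) * (\sum_(i < N.+1) (sqnorm h`_i - sqnorm k`_i))
  = sqnorm (h`_N + conjc a * k`_N).
Proof.
have E i : ((1 - conjc a *: 'X) * k)`_i = k`_i - conjc a * (if i == 0 then 0 else k`_i.-1).
  by rewrite mulrBl mul1r coefB -scalerAl coefZ coefXM.
have F i : (('X - a%:P) * h)`_i = (if i == 0 then 0 else h`_i.-1) - a * h`_i.
  by rewrite mulrBl coefB coefXM coefCM.
elim: N => [|N IH] e.
  have := e 0%N isT; rewrite E F /= mulr0 subr0 sub0r big_ord1 /= => ->.
  rewrite mulrN sqnormN; case: a (h`_0) {e E F} => a b [c d].
  by rewrite /sqnorm /=; ring.
rewrite big_ord_recr /= mulrDr {}IH; last by move=> i iN; rewrite e // ltnW.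
have := e N.+1 (leqnn _); rewrite E F /=.
case: a (h`_N) (h`_N.+1) (k`_N) (k`_N.+1) {e E F} => a b [c d] [c' d'] [x y] [x' y'] /= [].
rewrite /sqnorm /= => e1 e2.
(* Real and imaginary parts of the recurrence [k_(N+1) = h_N - a h_(N+1) + conj(a) k_N]; after
   substitution the claim is a polynomial identity. *)
have {e1}-> : x' = c + (a * x + b * y) - (a * c' - b * d') by lra.
have {e2}-> : y' = d + (a * y - b * x) - (a * d' + b * c') by lra.
ring.
Qed.

(** One factor is peeled off at a time: [h1], the truncated series of [B h / B'], is controlled by
    induction, and the defect formula compares [k] with [h1]. *)
Lemma blaschke_contraction (s : seq C) h k N :
  (forall a, a \in s -> sqnorm a < 1) ->
  eqX N ((\prod_(a <- s) (1 - conjc a *: 'X)) * k) ((\prod_(a <- s) ('X - a%:P)) * h) ->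
  \sum_(i < N) sqnorm k`_i <= \sum_(i < N) sqnorm h`_i.
Proof.
elim: s k => [|a s IH] k s1.
  by rewrite !big_nil !mul1r => e; apply: ler_sum => i _; rewrite e.
rewrite !big_cons.
set B' := \prod_(a <- s) _; set B := \prod_(a <- s) _ => e.
have B'0 : B'`_0 = 1.
  rewrite -horner_coef0 horner_prod big1 // => b _.
  by rewrite !hornerE ?mulr0 ?subr0.
have [h1 eh1] := eqX_div (B * h) N B'0.
have le1 : \sum_(i < N) sqnorm h1`_i <= \sum_(i < N) sqnorm h`_i.
  by apply: IH => // b bs; apply: s1; rewrite inE bs orbT.
apply: le_trans le1.
have e1 : eqX N ((1 - conjc a *: 'X) * k) (('X - a%:P) * h1).
  apply: (eqX_mulI B'0); rewrite mulrA [B' * _]mulrC.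
  apply: eqX_trans e _; rewrite mulrCA -[X in eqX _ X]mulrA.
  exact/eqX_mull/eqX_sym.
case: N e1 {e eh1 IH} => [|N] e1; first by rewrite !big_ord0.
have a1 : 0 < 1 - sqnorm a by rewrite subr_gt0 s1 // mem_head.
rewrite -subr_ge0 -sumrB -(pmulr_rge0 _ a1) (blaschke_factor_defect e1).
exact: sqnorm_ge0.
Qed.

(** Conjugation fixes the integer polynomial and its real root [t], hence permutes the other
    roots. *)
Lemma conj_real_poly_prod (s : seq C) (t : R) (mu : {poly int}) :
  map_poly intr mu = ('X - (t%:C)%C%:P) * \prod_(a <- s) ('X - a%:P) ->
  \prod_(a <- s) ('X - (conjc a)%:P) = \prod_(a <- s) ('X - a%:P).
Proof.
move=> E; have : map_poly (@conjc R) (map_poly intr mu) = map_poly intr mu.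
  by apply/polyP => i; rewrite !coef_map /= rmorph_int.
rewrite E rmorphM rmorphB /= map_polyX map_polyC /= oppr0 => /mulfI.
rewrite polyXsubC_eq0 => /(_ isT) <-.
rewrite rmorph_prod; apply: eq_bigr => a _.
by rewrite rmorphB /= map_polyX map_polyC.
Qed.


(** * Siegel's method for a dominant root [t] *)

Section SmallPisot.
Variables (t : R) (mu : {poly int}) (s : seq C).
Hypothesis mu_split :
  map_poly intr mu = ('X - (t%:C)%C%:P) * \prod_(a <- s) ('X - a%:P).
Hypothesis s_lt1 : forall a, a \in s -> sqnorm a < 1.

Let d := (size s).+1.
Let mu' := revpoly d mu.

Lemma map_revpoly_mu :
  map_poly intr mu' = (1 - (t%:C)%C *: 'X) * \prod_(a <- s) (1 - conjc a *: 'X).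
Proof.
rewrite -revpoly_map mu_split revpoly_mulXsubC ?size_prod_XsubC //; congr (_ * _).
rewrite -(conj_real_poly_prod mu_split).
have := revpoly_prod (map (@conjc R) s); rewrite size_map !big_map.
by [].
Qed.

Lemma mu_monic : mu`_d = 1.
Proof.
apply: (@intr_inj C); rewrite -coef_map /= mu_split.
have /monicP : \prod_(a <- (t%:C)%C :: s) ('X - a%:P) \is monic by apply: monic_prod_XsubC.
by rewrite lead_coefE size_prod_XsubC big_cons.
Qed.

Lemma revpoly_mu0 : mu'`_0 = 1.
Proof. by rewrite coef_poly /= subn0 mu_monic. Qed.

(** Here [u] is the integer power series of [mu / mu']. Multiplying by [1 - t X] leaves the Blaschke
    product over [s] applied to [(X - t) K], so the contraction applies; [K] is a free test
    polynomial. *)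
Lemma pisot_energy (u : {poly int}) (K : {poly R}) N : eqX N (mu' * u) mu ->
  \sum_(i < N) (((1 - t *: 'X) * map_poly intr u * K)`_i) ^+ 2
  <= \sum_(i < N) ((('X - t%:P) * K)`_i) ^+ 2.
Proof.
move=> e.
pose cR (p : {poly R}) := map_poly (real_complex R) p.
have cRi (p : {poly R}) i : (p`_i) ^+ 2 = sqnorm (cR p)`_i.
  by rewrite coef_map sqnorm_real.
under eq_bigr do rewrite cRi.
under [leRHS]eq_bigr do rewrite cRi.
apply: (blaschke_contraction s_lt1).
have cint (p : {poly int}) : cR (map_poly intr p) = map_poly intr p.
  by rewrite /cR -map_poly_comp; apply: eq_map_poly => z /=; rewrite rmorph_int.
have e' : eqX N (map_poly intr mu' * map_poly intr u) (map_poly intr mu : {poly C}).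
  by move=> i iN; rewrite -rmorphM /= !coef_map e.
have cRM p q : cR (p * q) = cR p * cR q by apply: rmorphM.
have cR1 : cR (1 - t *: 'X) = 1 - (t%:C)%C *: 'X.
  rewrite /cR rmorphB /= map_polyZ /= map_polyX; congr (_ - _); exact: rmorph1.
have cR2 : cR ('X - t%:P) = 'X - (t%:C)%C%:P.
  by rewrite /cR rmorphB /= map_polyX map_polyC.
rewrite !cRM cint cR1 cR2.
rewrite !mulrA [_ * (1 - _)]mulrC -map_revpoly_mu [X in eqX N X]mulrC.
rewrite [X in eqX N _ X]mulrC.
by apply: eqX_mull; rewrite [X in eqX N _ X]mulrC -mu_split.
Qed.


(* The 2 x 2 truncation of the contraction already rigidifies [mu / mu'] : its
   quadratic form at [(t^2 - 1, u1)] is negative unless [u1 = 0]. *)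
Lemma small_pisot_quotient : 1 < t -> t < 5 / 4 -> mu`_0 != 0 ->
  exists2 e : int, e ^+ 2 = 1 & mu = e *: mu'.
Proof.
move=> t_gt1 t_lt mu0.
have [u eu] := eqX_div mu d.+1 revpoly_mu0.
have eu2 : eqX 2 (mu' * u) mu by move=> i i2; apply: eu; apply: leq_trans i2 _.
have u0E : u`_0 = mu`_0.
  by rewrite -[RHS](eu 0%N) // coef0M revpoly_mu0 mul1r.
pose U : {poly R} := map_poly intr u.
have UE i : U`_i = (u`_i)%:~R by rewrite coef_map.
have quad (x y : R) : (U`_0 * x) ^+ 2 + (x * (U`_1 - t * U`_0) + y * U`_0) ^+ 2
    <= (t * x) ^+ 2 + (x - t * y) ^+ 2.
  have := pisot_energy (x%:P + y *: 'X) eu2; rewrite -/U !big_ord_recr !big_ord0 /= !add0r.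
  have c0 : ((1 - t *: 'X) * U * (x%:P + y *: 'X))`_0 = U`_0 * x.
    by rewrite !coef0M !(coefB, coefD, coefZ, coefC, coefX) /= ?coef1 /=; ring.
  have c1 : ((1 - t *: 'X) * U * (x%:P + y *: 'X))`_1 = x * (U`_1 - t * U`_0) + y * U`_0.
    rewrite !(coefM, big_ord_recr, big_ord0) /=.
    by rewrite !(coefB, coefD, coefZ, coefC, coefX) /= ?coef1 /= ?subn0 ?subnn; ring.
  have c2 : (('X - t%:P) * (x%:P + y *: 'X))`_0 = - (t * x).
    by rewrite !coef0M !(coefB, coefD, coefZ, coefC, coefX) /=; ring.
  have c3 : (('X - t%:P) * (x%:P + y *: 'X))`_1 = x - t * y.
    rewrite !(coefM, big_ord_recr, big_ord0) /=.
    by rewrite !(coefB, coefD, coefZ, coefC, coefX) /=; ring.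
  by rewrite c0 c1 c2 c3 sqrrN.
have t0 : 0 < t by rewrite (lt_trans ltr01).
have t2 : t ^+ 2 < 25 / 16 by nra.
(* The test polynomial [X] gives [u_0^2 <= t^2 < 2], and [u_0 = mu_0] is a nonzero integer. *)
have e1 : u`_0 ^+ 2 = 1.
  have := quad 0 1; rewrite !(mulr0, mul0r, mul1r, mulr1, expr0n, add0r, sub0r) /=.
  rewrite sqrrN UE -rmorphXn /= => h.
  have h2 : u`_0 ^+ 2 < 2 by rewrite -(ltr_int R); apply: le_lt_trans h _; lra.
  move: mu0 h2; rewrite -u0E; move: u`_0 => z z0 z2.
  have z1 : -1 <= z <= 1 by apply/andP; split; nia.
  by have [->|->] : z = 1 \/ z = -1 by lia.
have e1R : U`_0 ^+ 2 = 1 by rewrite UE -rmorphXn /= e1.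
(* The test polynomial [(t^2 - 1) + v X] with [v = u_0 u_1] confines the integer [v] between 0 and
   [2 (t^2 - 1) / t], which is below 1 because [t < 5/4]. *)
have u1 : u`_1 = 0.
  pose v : int := u`_0 * u`_1.
  have vR : v%:~R = U`_0 * U`_1 by rewrite rmorphM /= !UE.
  have h : v%:~R * (v%:~R * t - 2 * (t ^+ 2 - 1)) <= 0 :> R.
    have := quad (t ^+ 2 - 1) v%:~R.
    have -> : U`_1 = U`_0 * v%:~R by rewrite vR mulrA -expr2 e1R mul1r.
    have -> : (t ^+ 2 - 1) * (U`_0 * v%:~R - t * U`_0) + v%:~R * U`_0
       = U`_0 * ((t ^+ 2 - 1) * (v%:~R - t) + v%:~R) by ring.
    rewrite !exprMn e1R !mul1r -subr_le0 => h.
    have tm : 0 < t * (t ^+ 2 - 1) by rewrite mulr_gt0 // subr_gt0 exprn_egt1.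
    rewrite -(pmulr_rle0 _ tm); apply: le_trans h.
    by rewrite le_eqVlt; apply/orP; left; apply/eqP; ring.
  have v0 : v = 0.
    apply/eqP; rewrite eq_le; apply/andP; split; rewrite leNgt; apply/negP => hv.
      have v1 : 1 <= v%:~R :> R by rewrite ler1z; lia.
      have : 0 < v%:~R * t - 2 * (t ^+ 2 - 1) by nra.
      by move/(mulr_gt0 (lt_le_trans ltr01 v1)); rewrite ltNge h.
    have v1 : v%:~R <= -1 :> R by rewrite -(rmorphN1 (intr : int -> R)) ler_int; lia.
    have : v%:~R * t - 2 * (t ^+ 2 - 1) < 0 by nra.
    have v0 : v%:~R < 0 :> R by lra.
    by rewrite -(nmulr_rgt0 _ v0) ltNge h.
  by move: v0 e1; rewrite /v => /eqP; rewrite mulf_eq0 => /orP[/eqP->|/eqP].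
(* With [K = 1] the first two squares already sum to [1 + t^2], the whole right-hand side. Each
   further square, of [u_(j+2) - t u_(j+1)], must vanish, and [u_1 = 0] propagates. *)
have tail i : (0 < i)%N -> (i < d.+1)%N -> u`_i = 0.
  have := pisot_energy 1 eu; rewrite -/U /d !mulr1.
  have cW j : ((1 - t *: 'X) * U)`_j.+1 = U`_j.+1 - t * U`_j.
    by rewrite mulrBl mul1r coefB -scalerAl coefZ coefXM.
  have cG j : ('X - t%:P)`_j.+2 = 0 :> R by rewrite coefB coefX coefC subr0.
  rewrite !big_ord_recl /= -[bump 0 0]/1%N.
  rewrite [X in _ <= _ + (_ + X)]big1 => [|j _]; last by rewrite cG expr0n.
  have -> : ((1 - t *: 'X) * U)`_0 = U`_0.
    by rewrite coef0M !(coefB, coefZ, coefC, coefX) /= ?coef1; ring.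
  have -> : ('X - t%:P)`_0 = - t by rewrite !(coefB, coefC, coefX) /= sub0r.
  have -> : ('X - t%:P)`_1 = 1 by rewrite !(coefB, coefC, coefX) /= subr0.
  rewrite cW [U`_1]UE u1 sub0r !sqrrN expr1n addr0 exprMn e1R mulr1 addrA [t ^+ 2 + 1]addrC.
  rewrite gerDl => h.
  have {h} z j : (j < size s)%N -> U`_j.+2 = t * U`_j.+1.
    move=> js; apply/eqP; rewrite -subr_eq0 -cW -[_ == 0](@expf_eq0 _ _ 2).
    move: h; rewrite le_eqVlt ltNge sumr_ge0 ?orbF => [|? _]; last exact: sqr_ge0.
    rewrite psumr_eq0 => [/allP /(_ (Ordinal js))|? _]; last exact: sqr_ge0.
    by rewrite mem_index_enum => /(_ isT).
  case: i => // i _; elim: i => [|i IH]; first by [].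
  rewrite !ltnS => hi; apply: (@intr_inj R); rewrite -UE z //.
  by rewrite UE IH ?mulr0 // !ltnS ltnW.
exists (u`_0) => //; apply/polyP => i; rewrite coefZ.
case: (ltnP i d.+1) => hi.
  rewrite -(eu _ hi).
  have h : eqX d.+1 u (u`_0)%:P.
    by move=> j hj; rewrite coefC; case: j hj => [|j] // hj; rewrite tail.
  by rewrite (eqX_mull mu' h) // mulrC coefCM.
rewrite coef_poly ltnNge hi /= mulr0; apply: nth_default.
apply: leq_trans hi; rewrite -(size_map_inj_poly (@intr_inj C) (rmorph0 _)) mu_split.
have -> : ('X - (t%:C)%C%:P) * \prod_(a <- s) ('X - a%:P) = \prod_(a <- (t%:C)%C :: s) ('X - a%:P).
  by rewrite big_cons.
by rewrite size_prod_XsubC.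
Qed.

(** Being [mu'] up to sign, [mu] has the root [1/t] and constant term of modulus 1, which leaves no
    further root in the open disc. Then [mu] is [X^2 - (t + 1/t) X + 1], yet [t + 1/t] lies strictly
    between 2 and 3. *)
Lemma no_small_pisot : 1 < t -> t < 5 / 4 -> mu`_0 != 0 -> False.
Proof.
move=> t_gt1 t_lt mu0; have t0 : 0 < t by rewrite (lt_trans ltr01).
have [e e1 emu] := small_pisot_quotient t_gt1 t_lt mu0.
pose rho : C := (t^-1%:C)%C.
have rho_s : rho \in s.
  have : root (map_poly intr mu) rho.
    rewrite emu map_polyZ rootZ; last first.
      by rewrite intr_eq0; apply: contra_eq_neq e1 => ->.
    rewrite map_revpoly_mu rootM; apply/orP; left.
    have tr : (t%:C)%C * rho = 1 by rewrite -rmorphM divff ?gt_eqF.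
    by rewrite /root !hornerE tr subrr.
  rewrite mu_split rootM root_XsubC root_prod_XsubC => /orP[/eqP /(@complexI R)|//].
  have := invf_lt1 t0; rewrite t_gt1 => h1 h2; exfalso.
  by move: h1; rewrite h2 ltNge ltW.
have permS : perm_eq s (rho :: rem rho s) by apply: perm_to_rem.
have prod1 : \prod_(a <- rem rho s) sqnorm a = 1.
  have : sqnorm (mu`_0)%:~R = 1.
    have -> : mu`_0 = e by rewrite emu coefZ revpoly_mu0 mulr1.
    by rewrite -(rmorph_int (real_complex R)) sqnorm_real -rmorphXn /= e1.
  have -> : (mu`_0)%:~R = (map_poly intr mu).[0] :> C by rewrite horner_coef0 coef_map.
  rewrite mu_split hornerM hornerXsubC horner_prod sub0r sqnormM sqnormN sqnorm_real.
  rewrite sqnorm_prod (perm_big _ permS) /= big_cons hornerXsubC sub0r sqnormN sqnorm_real.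
  rewrite exprVn mulrA divff ?mul1r ?expf_neq0 ?gt_eqF // => h.
  by rewrite -[RHS]h; apply: eq_bigr => a _; rewrite hornerXsubC sub0r sqnormN.
have rem0 : rem rho s = [::].
  have: forall a, a \in rem rho s -> sqnorm a < 1 by move=> a /mem_rem /s_lt1.
  case: (rem rho s) prod1 => // a l; rewrite big_cons => h lt1; exfalso.
  have := lt1 a (mem_head _ _).
  suff : \prod_(b <- l) sqnorm b <= 1.
    move: h (sqnorm_ge0 a); move: (sqnorm a) (\prod_(b <- l) _) => x y; nra.
  rewrite big_seq; apply: prodr_ile1 => b bl; rewrite sqnorm_ge0 ltW //.
  by apply: lt1; rewrite inE bl orbT.
have : (mu`_1)%:~R = ((- (t + t^-1))%:C)%C :> C.
  rewrite -coef_map /= mu_split (perm_big _ permS) /= rem0 big_seq1.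
  rewrite coefM !big_ord_recr big_ord0 /= !(coefB, coefC, coefX) /=.
  rewrite add0r sub0r !subr0 mulr1 mul1r sub0r.
  by rewrite -opprD -rmorphD /= -rmorphN.
rewrite -(rmorph_int (real_complex R)) => /(@complexI R) E.
have tV : t * t^-1 = 1 by rewrite divff ?gt_eqF.
have tV0 : 0 < t^-1 by rewrite invr_gt0.
have l1 : (-3)%:~R < (mu`_1)%:~R :> R by rewrite E; nra.
have l2 : (mu`_1)%:~R < (-2)%:~R :> R by rewrite E; nra.
by move: l1 l2; rewrite !ltr_int; lia.
Qed.

End SmallPisot.
End Pisot.

(** * Finite spectra force a Pisot base *)

Section PolyEval.
Variable R : realType.
Implicit Types (x : R) (H : {poly int}).

Definition peval x H : R := (map_poly intr H).[x].

Lemma peval0 x : peval x 0 = 0.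
Proof. by rewrite /peval map_poly0 horner0. Qed.

Lemma pevalD x H H' : peval x (H + H') = peval x H + peval x H'.
Proof. by rewrite /peval rmorphD hornerD. Qed.

Lemma pevalN x H : peval x (- H) = - peval x H.
Proof. by rewrite /peval rmorphN hornerN. Qed.

Lemma pevalB x H H' : peval x (H - H') = peval x H - peval x H'.
Proof. by rewrite pevalD pevalN. Qed.

Lemma pevalM x H H' : peval x (H * H') = peval x H * peval x H'.
Proof. by rewrite /peval rmorphM hornerM. Qed.

Lemma pevalC x c : peval x c%:P = c%:~R.
Proof. by rewrite /peval map_polyC hornerC. Qed.

Lemma pevalZ x c H : peval x (c *: H) = c%:~R * peval x H.
Proof. by rewrite -mul_polyC pevalM pevalC. Qed.

Lemma pevalXn x n : peval x 'X^n = x ^+ n.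
Proof. by rewrite /peval map_polyXn hornerXn. Qed.

Lemma pevalX x : peval x 'X = x.
Proof. by rewrite /peval map_polyX hornerX. Qed.

Definition height_le (m : int) H := forall i, `|H`_i| <= m.

Lemma height_le_mulXD m c H : height_le m H -> `|c| <= m -> height_le m (H * 'X + c%:P).
Proof.
move=> h hc i; rewrite coefD coefMX coefC.
by case: i => [|i] /=; rewrite ?add0r // addr0.
Qed.

Definition spectrum x (m : int) (L : R) : set R :=
  [set y | exists2 H, height_le m H & y = peval x H /\ `|y| <= L].

End PolyEval.

Section MeyerPisot.
Variable (R : realType) (p : R).
Local Notation C := R[i].
Hypothesis p_gt1 : 1 < p.
Hypothesis p_lt2 : p < 2.
Hypothesis fin : forall m L, finite_set (spectrum p m L).

Lemma peval_pigeonhole m L (f : nat -> {poly int}) :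
  (forall n, height_le m (f n) /\ `|peval p (f n)| <= L) ->
  exists i j, (i < j)%N /\ peval p (f i) = peval p (f j).
Proof.
move=> hf; apply: contrapT => no.
have inj : injective (fun n => peval p (f n)).
  move=> i j e; apply: contrapT => /eqP; rewrite neq_ltn => /orP[] l; apply: no.
    by exists i, j.
  by exists j, i.
apply: infinite_nat.
have -> : [set: nat] = (fun n => peval p (f n)) @^-1` (spectrum p m L).
  by apply/seteqP; split=> // n _ /=; have [h1 h2] := hf n; exists (f n).
by apply: finite_preimage (fin m L) => i j _ _; exact: inj.
Qed.

(** The greedy recurrence [H -> X H - floor(p H(p))] from 1 keeps the value in [[0, 1]] and the
    height at most 2, with one monic polynomial in each degree. Two of them agree at [p], and their
    difference is monic. *)
Lemma monic_annihilator : exists2 H : {poly int}, H \is monic & peval p H = 0.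
Proof.
have P1 := p_gt1; have P2 := p_lt2.
pose f := fix f n := if n is n.+1 then f n * 'X + (- Num.floor (p * peval p (f n)))%:P
                     else 1 : {poly int}.
have v n : 0 <= peval p (f n) <= 1.
  case: n => [|n] /=; first by rewrite pevalC ler01 lexx.
  rewrite pevalD pevalM pevalX pevalC rmorphN /= mulrC.
  have := floor_itv (p * peval p (f n)); rewrite intrD => /andP[].
  by move: (p * _) (_%:~R) => x y h1 h2; apply/andP; split; lra.
have h n : height_le 2 (f n).
  elim: n => [|n IH] /=; first by move=> i; rewrite coefC; case: eqP.
  apply: height_le_mulXD => //; rewrite normrN.
  have /andP[v0 v1] := v n.
  rewrite ger0_norm ?floor_ge0 ?mulr_ge0 ?(ltW (lt_trans ltr01 P1)) //.
  rewrite -(ler_int R); apply: le_trans (floor_le_tmp _) _; nra.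
have szf n : size (f n) = n.+1 /\ lead_coef (f n) = 1.
  elim: n => [|n [IH1 IH2]] /=; first by rewrite size_poly1 lead_coef1.
  have nz : f n != 0 by rewrite -size_poly_gt0 IH1.
  have sz : size (f n * 'X) = n.+2 by rewrite size_mulX // IH1.
  have lt : (size ((- Num.floor (p * peval p (f n)))%:P) < size (f n * 'X)%R)%N.
    by rewrite sz (leq_ltn_trans (size_polyC_leq1 _)).
  by rewrite size_polyDl // lead_coefDl // sz lead_coefMX.
have [|i [j [ij e]]] := @peval_pigeonhole 2 1 f.
  move=> n; split; first exact: h.
  by have /andP[v0 v1] := v n; rewrite ger0_norm.
exists (f j - f i); last by rewrite pevalB e subrr.
apply/monicP; rewrite lead_coefDl ?size_polyN; first by have [] := szf j.
by rewrite !(szf _).1 ltnS.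
Qed.

(** Gauss's lemma: the primitive part of an annihilator of least degree divides every annihilator
    over the integers, and dividing a monic one makes it monic. *)
Lemma minimal_annihilator : exists mu : {poly int},
  [/\ mu \is monic, peval p mu = 0 &
      forall H, peval p H = 0 -> exists r, H = mu * r].
Proof.
have [M Mmon M0] := monic_annihilator.
pose P n := `[< exists H : {poly int}, [/\ H != 0, peval p H = 0 & size H = n] >].
have exP : exists n, P n.
  by exists (size M); apply/asboolP; exists M; rewrite monic_neq0.
case: (ex_minnP exP) => n /asboolP[m0 [m0n0 m00 sm0]] minn.
have dv H : peval p H = 0 -> exists r, H = zprimitive m0 * r.
  move=> H0; have : (m0 %| H)%R.
    rewrite /dvdp; apply: contraT => nz.
    have : P (size (H %% m0)%R).
      apply/asboolP; exists (H %% m0)%R; split=> //.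
      have := congr1 (peval p) (Pdiv.Idomain.divp_eq H m0).
      by rewrite pevalZ H0 mulr0 pevalD pevalM m00 mulr0 add0r.
    by move/minn; rewrite leqNgt -sm0 ltn_modp m0n0.
  by case/dvdpP_int => r ->; exists r.
exists (zprimitive m0); split=> //.
  have [r Mr] := dv M M0.
  have := monicP Mmon; rewrite Mr lead_coefM.
  have := sgz_lead_primitive m0; rewrite m0n0.
  rewrite monicE; move: (lead_coef _) (lead_coef r) => x y sx xy.
  apply/eqP; move: sx => /= /eqP; rewrite sgz_cp0 => x0.
  have : (x %| 1)%Z by apply/dvdzP; exists y; rewrite mulrC.
  by rewrite dvdz1; lia.
have := congr1 (peval p) (zpolyEprim m0); rewrite m00 pevalZ => /esym/eqP.
rewrite mulf_eq0 intr_eq0 zcontents_eq0 (negbTE m0n0) /= => /eqP //.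
Qed.

Lemma sqnorm_lt_add (z c : C) (x : R) : x != 0 -> c != 0 ->
  0 <= x * (complex.Re z * complex.Re c + complex.Im z * complex.Im c) ->
  sqnorm z < sqnorm (z + c * (x%:C)%C).
Proof.
case: z => a b; case: c => u v /= x0 c0 h.
have h2 : 0 < x ^+ 2 * (u ^+ 2 + v ^+ 2).
  apply: mulr_gt0; first by rewrite exprn_even_gt0.
  rewrite lt_def paddr_eq0 ?sqr_ge0 // !sqrf_eq0 addr_ge0 ?sqr_ge0 // andbT.
  by move: c0; rewrite eq_complex.
by rewrite /sqnorm /=; lra.
Qed.

(* Along H_{n+1} = X H_n + e_n with H_n(p) kept bounded, the quantity
   a H_n(a) - p H_n(p) escapes when |a| >= 1, because H_{n+1}(p) can be given either sign. *)
Lemma conjugate_lt1 (a : C) : a != (p%:C)%C ->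
  (forall H : {poly int}, peval p H = 0 -> (map_poly intr H).[a] = 0) ->
  sqnorm a < 1.
Proof.
move=> ap wd; have P1 := p_gt1; have P2 := p_lt2; rewrite ltNge; apply/negP => a1.
pose evc (H : {poly int}) : C := (map_poly intr H).[a].
pose tau H := a * evc H - (p%:C)%C * ((peval p H)%:C)%C.
pose c := a - (p%:C)%C.
pose dot (H : {poly int}) := complex.Re (a * tau H) * complex.Re c
                           + complex.Im (a * tau H) * complex.Im c.
(* The digit puts the next value at [p] into [[1, 2]] or [[-2, -1]], on the side where adding that
   multiple of [c] lengthens [a tau]. *)
pose eps H : int := if 0 <= dot H then 1 - Num.floor (p * peval p H)
                    else - 1 - Num.ceil (p * peval p H).
pose f := fix f n := if n is n.+1 then f n * 'X + (eps (f n))%:P else 0 : {poly int}.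
have fS n : peval p (f n.+1) = p * peval p (f n) + (eps (f n))%:~R.
  by rewrite /= pevalD pevalM pevalX pevalC mulrC.
have sgn n : if 0 <= dot (f n) then 1 <= peval p (f n.+1) <= 2
             else -2 <= peval p (f n.+1) <= -1.
  rewrite fS /eps; case: (0 <= dot (f n)).
    have := floor_itv (p * peval p (f n)); rewrite !intrD !rmorphN /= => /andP[].
    by move: (p * _) (_%:~R) => x y h1 h2; apply/andP; split; lra.
  have := ceil_itv (p * peval p (f n)); rewrite !intrD !rmorphN /= => /andP[].
  by move: (p * _) (_%:~R) => x y h1 h2; apply/andP; split; lra.
have bnd n : -2 <= peval p (f n) <= 2.
  case: n => [|n]; first by rewrite /= peval0; apply/andP; split; lra.
  by have := sgn n; case: ifP => _ /andP[h1 h2]; apply/andP; split; lra.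
(* The height 6 is [2 + 2 * 2]: a digit equals [H_(n+1)(p) - p H_n(p)], both values are at most 2 in
   modulus, and [p < 2]. *)
have hf n : height_le 6 (f n).
  elim: n => [|n IH]; first by move=> i; rewrite coef0.
  apply: height_le_mulXD => //; rewrite -(ler_int R).
  have -> : `|eps (f n)|%:~R = `|peval p (f n.+1) - p * peval p (f n)|.
    by rewrite fS addrC addKr intr_norm.
  rewrite ler_norml; have /andP[b1 b2] := bnd n; have /andP[b3 b4] := bnd n.+1.
  by apply/andP; split; nra.
have grow n : sqnorm (tau (f n)) < sqnorm (tau (f n.+1)).
  have E : tau (f n.+1) = a * tau (f n) + c * ((peval p (f n.+1))%:C)%C.
    rewrite /tau fS /evc /= rmorphD rmorphM /= map_polyX map_polyC /= hornerD hornerMX hornerC.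
    rewrite -/(evc _) rmorphD rmorphM /= (rmorph_int (real_complex R)) /c.
    by ring.
  rewrite E; apply: (@le_lt_trans _ _ (sqnorm (a * tau (f n)))).
    by rewrite sqnormM ler_peMl // sqnorm_ge0.
  apply: sqnorm_lt_add; rewrite ?subr_eq0 //.
    by have := sgn n; case: ifP => _ /andP[h1 h2]; apply/eqP; lra.
  have := sgn n; rewrite -/(dot (f n)); case: ifP => h /andP[h1 h2].
    by apply: mulr_ge0 => //; lra.
  by apply: mulr_le0; [lra | apply: ltW; rewrite ltNge h].
(* Equal values at [p] give equal values at [a] by [wd], hence equal [tau], against the strict
   growth of its modulus. *)
have [|i [j [ij e]]] := @peval_pigeonhole 6 2 f.
  by move=> n; split=> //; rewrite ler_norml.
have mono : {homo (fun n => sqnorm (tau (f n))) : m n / (m < n)%N >-> m < n}.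
  by apply: homo_ltn grow => ? ? ?; apply: lt_trans.
have := mono _ _ ij; suff -> : tau (f i) = tau (f j) by rewrite ltxx.
rewrite /tau e; congr (_ * _ - _); apply/eqP; rewrite -subr_eq0 -hornerN -hornerD -rmorphB.
by apply/eqP; apply: wd; rewrite pevalB e subrr.
Qed.

(** The minimal polynomial of [p] has nonzero constant term, [p] is a simple root of it, and
    [conjugate_lt1] puts all other roots into the open disc; [no_small_pisot] excludes this. *)
Lemma spectrum_not_finite : p < 5 / 4 -> False.
Proof.
move=> p_lt; have P1 := p_gt1; have p0 : 0 < p by rewrite (lt_trans ltr01).
have [mu [mon mu0 dv]] := minimal_annihilator.
have szmu : (1 < size mu)%N.
  rewrite ltnNge; apply/negP => /size1_polyC e.
  move: mu0 (monic_neq0 mon); rewrite e pevalC => /eqP.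
  by rewrite intr_eq0 => /eqP ->; rewrite polyC0 eqxx.
have mu_min H : peval p H = 0 -> (size H < size mu)%N -> H = 0.
  move=> /dv[r ->]; have [->|r0] := eqVneq r 0; first by rewrite mulr0.
  rewrite size_monicM // -subn1; have := size_poly_gt0 r; rewrite r0; lia.
have wd (a : C) H : root (map_poly intr mu) a -> peval p H = 0 -> (map_poly intr H).[a] = 0.
  by move=> /rootP ra /dv[r ->]; rewrite rmorphM hornerM ra mul0r.
pose muC : {poly C} := map_poly intr mu.
have [rs] := closed_field_poly_normal muC.
have -> : lead_coef muC = 1.
  by apply/monicP; rewrite monic_map.
rewrite scale1r => muE.
have evC (H : {poly int}) : (map_poly intr H).[(p%:C)%C] = ((peval p H)%:C)%C.
  rewrite -horner_map -map_poly_comp; congr (_.[_]).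
  by apply: eq_map_poly => z /=; rewrite (rmorph_int (real_complex R)).
have prs : (p%:C)%C \in rs.
  by rewrite -root_prod_XsubC -muE /root evC mu0.
have permS := perm_to_rem prs.
pose s := rem (p%:C)%C rs.
have split : muC = ('X - (p%:C)%C%:P) * \prod_(a <- s) ('X - a%:P).
  by rewrite muE (perm_big _ permS) /= big_cons.
have mu_0 : mu`_0 != 0.
  apply/eqP => c0.
  have e : mu = drop_poly 1 mu * 'X.
    have := poly_take_drop 1 mu; rewrite expr1.
    suff -> : take_poly 1 mu = 0 by rewrite add0r.
    by apply/polyP => i; rewrite coef_take_poly coef0; case: i => //=.
  have : drop_poly 1 mu = 0.
    apply: mu_min; last by rewrite size_drop_poly; lia.
    move: mu0; rewrite {1}e pevalM pevalX => /eqP.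
    by rewrite mulf_eq0 (gt_eqF p0) orbF => /eqP.
  by move=> h; move: (monic_neq0 mon); rewrite e h mul0r eqxx.
apply: (no_small_pisot split) => // a asr.
apply: conjugate_lt1; last first.
  move=> H; apply: wd; rewrite -/muC split rootM; apply/orP; right.
  by rewrite root_prod_XsubC.
apply/eqP => ap; move: asr; rewrite ap => ps.
(* At a double root the derivative would be an annihilator of smaller degree. *)
have dmu : peval p mu^`() = 0.
  apply: (@complexI R); rewrite -evC -deriv_map -/muC split (perm_big _ (perm_to_rem ps)) /=.
  rewrite big_cons !derivM derivXsubC mul1r !hornerE /= !subrr.
  by rewrite !(mul0r, mulr0, addr0).
have : mu^`() = 0 by apply: mu_min => //; rewrite lt_size_deriv // monic_neq0.
move=> /(congr1 (fun q : {poly int} => q`_(size mu).-2)).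
rewrite coef_deriv coef0; have -> : ((size mu).-2.+1 = (size mu).-1)%N by lia.
rewrite -lead_coefE (monicP mon) => /eqP; lia.
Qed.

End MeyerPisot.

(** * Separated digit sums are of finite type *)

Section Supports.
Implicit Types (a b : pred nat) (H : {poly int}).

(* [a] is a set of residues modulo 4. *)
Definition supp4 a H := forall i, ~~ a (i %% 4)%N -> H`_i = 0.

Definition zero_one H := forall i, H`_i = 0 \/ H`_i = 1.

Definition digits a H := zero_one H /\ supp4 a H.

Definition trits a H := height_le 1 H /\ supp4 a H.

Lemma supp4D a H H' : supp4 a H -> supp4 a H' -> supp4 a (H + H').
Proof. by move=> h h' i ai; rewrite coefD h // h' // addr0. Qed.

Lemma supp4N a H : supp4 a H -> supp4 a (- H).
Proof. by move=> h i ai; rewrite coefN h // oppr0. Qed.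

Lemma supp4W a b H : (forall r, a r -> b r) -> supp4 a H -> supp4 b H.
Proof. by move=> ab h i bi; apply: h; apply: contra bi; apply: ab. Qed.

Lemma supp4_mulX4n a n H : supp4 a H -> supp4 a (H * 'X^(4 * n)).
Proof.
move=> h i ai; rewrite coefMXn; case: ltnP => // ni.
by apply: h; move: ai; rewrite -{1}(subnK ni) -modnDmr mulnC modnMl addn0.
Qed.

Lemma supp4_mulXn a b j H : (forall r, a (r %% 4)%N -> b ((r + j) %% 4)%N) ->
  supp4 a H -> supp4 b (H * 'X^j).
Proof.
move=> ab h i bi; rewrite coefMXn; case: ltnP => // ji.
by apply: h; apply: contra bi => /ab; rewrite subnK.
Qed.

Lemma digitsW a b H : (forall r, a r -> b r) -> digits a H -> digits b H.
Proof. by move=> ab [h1 h2]; split=> //; apply: supp4W h2. Qed.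

Lemma digits0 a : digits a 0.
Proof. by split=> i; rewrite coef0 //; left. Qed.

Lemma zero_one_cat n H H' : (size H <= n)%N -> zero_one H -> zero_one H' ->
  zero_one (H + H' * 'X^n).
Proof.
move=> sH h h' i; rewrite coefD coefMXn; case: ltnP => ni; first by rewrite addr0.
by rewrite nth_default ?add0r // (leq_trans sH).
Qed.

Lemma digits_cat a n H H' : (size H <= 4 * n)%N -> digits a H -> digits a H' ->
  digits a (H + H' * 'X^(4 * n)).
Proof.
move=> sH [h1 h2] [h1' h2']; split; first exact: zero_one_cat.
by apply: supp4D => //; apply: supp4_mulX4n.
Qed.

Lemma digits_mulX4n a n H : digits a H -> digits a (H * 'X^(4 * n)).
Proof.
by move=> h; have := @digits_cat a n 0 H; rewrite add0r size_poly0; apply=> //; apply: digits0.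
Qed.

Lemma zero_one_height H : zero_one H -> height_le 1 H.
Proof. by move=> h i; case: (h i) => ->. Qed.

Lemma zero_one_disjoint H H' : zero_one H -> zero_one H' ->
  (forall i, H`_i = 0 \/ H'`_i = 0) -> zero_one (H + H').
Proof. by move=> h h' d i; rewrite coefD; case: (d i) => ->; rewrite ?add0r ?addr0. Qed.

Lemma trits_sub a H : trits a H ->
  exists U V, [/\ digits a U, digits a V & H = U - V].
Proof.
move=> [h s]; pose U := \poly_(i < size H) ((H`_i == 1) : nat)%:Z.
pose V := \poly_(i < size H) ((H`_i == -1) : nat)%:Z.
exists U, V; split.
- split=> i; rewrite coef_poly; first by case: ifP => _; [case: eqP; [right|left]|left].
  by move=> ai; rewrite s //=; case: ifP.
- split=> i; rewrite coef_poly; first by case: ifP => _; [case: eqP; [right|left]|left].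
  by move=> ai; rewrite s //=; case: ifP.
apply/polyP => i; rewrite coefB !coef_poly; case: ltnP => hi; last by rewrite nth_default.
by have := h i; move: H`_i => z; lia.
Qed.

Lemma finite_bounded_polys (n : nat) :
  finite_set [set H : {poly int} | height_le 1 H /\ (size H <= n)%N].
Proof.
pose g (f : {ffun 'I_n -> 'I_3}) : {poly int} :=
  \poly_(i < n) (if insub i is Some j then (f j : nat)%:Z - 1 else 0).
apply: (@sub_finite_set _ _ (range g)); last by apply: finite_image.
move=> H [h sH]; exists [ffun j : 'I_n => inord (absz (H`_j + 1))] => //.
apply/polyP => i; rewrite coef_poly; case: ltnP => hi; last first.
  by rewrite nth_default // (leq_trans sH).
rewrite insubT /= ffunE /=; have := h i => hi'.
by rewrite inordK; move: hi'; move: H`_i => z; lia.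
Qed.

End Supports.

Section FiniteType.
Variable (R : realType) (p : R).
Hypothesis p_gt1 : 1 < p.
Hypothesis p4_lt2 : p ^+ 4 < 2.
Local Notation P := (p ^+ 4).
Local Notation ev := (peval p).

Lemma p_gt0 : 0 < p. Proof. exact: lt_trans ltr01 p_gt1. Qed.
Hint Resolve p_gt0 : core.

Lemma pow4_gt1 : 1 < P. Proof. by rewrite exprn_egt1. Qed.

Lemma pow4_gt0 : 0 < P. Proof. by rewrite exprn_gt0. Qed.
Hint Resolve pow4_gt0 : core.

Lemma ev_mulX4n n H : ev (H * 'X^(4 * n)) = ev H * P ^+ n.
Proof. by rewrite pevalM pevalXn exprM. Qed.

(** The largest digit sum on the first [n] positions divisible by 4. *)
Definition geom n : R := \sum_(i < n) P ^+ i.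

Lemma geomS n : geom n.+1 = P * geom n + 1.
Proof.
rewrite /geom big_ord_recl expr0 addrC mulr_sumr; congr (_ + _).
by apply: eq_bigr => i _; rewrite lift0 -exprS.
Qed.

Lemma geomE n : (P - 1) * geom n = P ^+ n - 1.
Proof. by rewrite [RHS]subrX1. Qed.

Lemma geomD m n : geom (m + n) = P ^+ m * geom n + geom m.
Proof.
rewrite /geom big_split_ord /= addrC; congr (_ + _).
by rewrite mulr_sumr; apply: eq_bigr => i _; rewrite exprD.
Qed.

Lemma geom_ge_nat n : n%:R <= geom n.
Proof.
elim: n => [|n IH]; first by rewrite /geom big_ord0.
rewrite geomS -addn1 natrD lerD2r (le_trans IH) // ler_peMl ?(ltW pow4_gt1) //.
exact: le_trans IH.
Qed.

Lemma geom_ge0 n : 0 <= geom n.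
Proof. exact: le_trans (ler0n _ _) (geom_ge_nat n). Qed.

Lemma geom_unbounded (x : R) : exists n, x <= geom n.
Proof.
exists (Num.truncn x).+1; apply: le_trans (geom_ge_nat _).
exact/ltW/truncnS_gt.
Qed.

Lemma pow4_unbounded (x : R) : exists n, x <= P ^+ n.
Proof.
have [n hn] := geom_unbounded (x / (P - 1)); exists n.
have h : 0 < P - 1 by rewrite subr_gt0 pow4_gt1.
move: hn; rewrite ler_pdivrMr // mulrC geomE => h1.
by apply: le_trans h1 _; rewrite gerBl.
Qed.

(** Since [P < 2], a value approximating [(v - 1) / P] from above lies, once multiplied by [P], in
    [[v - 1, v + 1)]; the constant digit then brings it into [[v, v + 1)]. The size bound leaves
    room for a shift by up to [X^3]. *)
Lemma fill_residue0 n v : 0 <= v <= geom n ->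
  exists H, [/\ digits (pred1 0%N) H, (size H <= 4 * n - 3)%N & v <= ev H < v + 1].
Proof.
elim: n v => [|n IH] v /andP[v0 vn].
  exists 0; split; [exact: digits0 | by rewrite size_poly0|].
  by rewrite peval0; move: vn; rewrite /geom big_ord0 => vn; apply/andP; split; lra.
have step (H : {poly int}) (c : bool) : digits (pred1 0%N) H -> (size H <= 4 * n - 3)%N ->
    digits (pred1 0%N) ((c%:R)%:P + H * 'X^(4 * 1)) /\
    (size ((c%:R)%:P + H * 'X^(4 * 1))%R <= 4 * n.+1 - 3)%N.
  move=> dH sH; have sc : (size ((c%:R : int)%:P) <= 1)%N by apply: size_polyC_leq1.
  split.
    apply: digits_cat => //; first by apply: leq_trans sc _.
    split=> i; rewrite coefC; last by case: eqP => [->|].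
    by case: eqP => _; [case: c {sc}; [right|left] | left].
  apply/leq_sizeP => j hj; rewrite coefD coefC coefMXn.
  case: eqP => [j0|_]; first by lia.
  case: ltnP => hj'; first by rewrite addr0.
  by rewrite nth_default ?addr0 //; apply: leq_trans sH _; lia.
have [v1|v1] := lerP v 1.
  have [->|vn0] := eqVneq v 0.
    exists 0; split; [exact: digits0 | by rewrite size_poly0|].
    by rewrite peval0 lexx add0r ltr01.
  have [h1 h2] := step 0 true (digits0 _) (eq_ind_r (fun k => k <= _)%N (leq0n _) (size_poly0 _)).
  exists ((true%:R)%:P + 0 * 'X^(4 * 1)); split=> //.
  rewrite mul0r addr0 pevalC v1 ltrDr lt_def vn0.
  by [].
have P1 := pow4_gt1; have P2 := p4_lt2.
have [|H [dH sH /andP[h1 h2]]] := IH ((v - 1) / P).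
  rewrite divr_ge0 ?subr_ge0 ?(ltW v1) ?(ltW pow4_gt0) //=.
  by rewrite ler_pdivrMr // lerBlDr mulrC -geomS.
rewrite ler_pdivrMr // in h1.
rewrite -ltrBlDr ltr_pdivlMr // in h2.
have [le|lt] := lerP v (ev H * P).
  have [k1 k2] := step H false dH sH; exists ((false%:R)%:P + H * 'X^(4 * 1)); split=> //.
  rewrite add0r ev_mulX4n expr1 le /=; lra.
have [k1 k2] := step H true dH sH; exists ((true%:R)%:P + H * 'X^(4 * 1)); split=> //.
by rewrite pevalD pevalC ev_mulX4n expr1 /=; apply/andP; split; lra.
Qed.

Lemma fill_residue j n v : (j < 4)%N -> 0 <= v <= p ^+ j * geom n ->
  exists H, [/\ digits (pred1 j) H, (size H <= 4 * n)%N & v <= ev H < v + p ^+ j].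
Proof.
move=> j4 /andP[v0 vn]; have pj : 0 < p ^+ j by rewrite exprn_gt0.
have [|H [[z s] sH /andP[h1 h2]]] := @fill_residue0 n (v / p ^+ j).
  by rewrite divr_ge0 ?(ltW pj) //= ler_pdivrMr // mulrC.
exists (H * 'X^j); split.
- split.
    by have := @zero_one_cat j 0 H; rewrite size_poly0 add0r; apply=> // i; rewrite coef0; left.
  apply: supp4_mulXn s => r /= /eqP r0.
  by rewrite -modnDml r0 add0n modn_small.
- apply/leq_sizeP => i hi; rewrite coefMXn; case: ltnP => // ji.
  by rewrite nth_default //; apply: leq_trans sH _; lia.
rewrite pevalM pevalXn; rewrite ler_pdivrMr // in h1; rewrite h1 /=.
by rewrite -ltr_pdivlMr // mulrDl divff ?gt_eqF.
Qed.

(** The residues 0, 1, 2; residue 3 is kept free for the approximation in [orbit_density]. *)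
Definition offT : pred nat := fun r => r != 3.

Lemma full_residue2 k :
  exists e, [/\ digits offT e, (size e <= 4 * k)%N & ev e = p ^+ 2 * geom k].
Proof.
elim: k => [|k [e [d s E]]].
  by exists 0; rewrite /geom big_ord0 mulr0 peval0 size_poly0; split=> //; apply: digits0.
exists ('X^2 + e * 'X^(4 * 1)); split.
- apply: digits_cat => //; first by rewrite size_polyXn.
  split=> i; rewrite coefXn; first by case: eqP; [right|left].
  by case: eqP => [->|].
- apply/leq_sizeP => i hi; rewrite coefD coefXn coefMXn.
  case: eqP => [?|_]; first by lia.
  case: ltnP => [?|hi']; first by lia.
  by rewrite nth_default // (leq_trans s) //; lia.
by rewrite pevalD pevalXn ev_mulX4n E geomS; ring.
Qed.

Section Separated.
Variable delta : R.
Hypothesis delta_gt0 : 0 < delta.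
Hypothesis sep : forall H H', digits offT H -> digits offT H' ->
  `|ev H - ev H'| < delta -> ev H = ev H'.

(** The window has length [p^2], the error of [fill_residue] on residue 2. *)
Definition config (z : R) (s : seq {poly int}) :=
  [/\ 0 <= z, forall g, g \in s -> digits offT g,
      forall g, g \in s -> z <= ev g <= z + p ^+ 2 & uniq (map ev s)].

(** By separation, values in one cell of length [delta] coincide, so the index of the cell is
    injective on [s]. *)
Lemma config_size z s : config z s -> (size s <= (Num.truncn (p ^+ 2 / delta)).+1)%N.
Proof.
move=> [z0 ds itv us]; pose k g := Num.truncn ((ev g - z) / delta).
have k0 g : g \in s -> 0 <= (ev g - z) / delta.
  by move=> /itv/andP[h _]; rewrite divr_ge0 ?subr_ge0 // ltW.
have uk : uniq (map k s).
  rewrite map_inj_in_uniq; first exact: map_uniq us.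
  move=> g h gs hs e; have := @uniqP _ 0 _ us (index g s) (index h s).
  rewrite !inE size_map !index_mem gs hs => /(_ isT isT).
  rewrite !(nth_map 0) ?index_mem // !nth_index //.
  suff eq : ev g = ev h by move=> /(_ eq) /(congr1 (nth 0 s)); rewrite !nth_index.
  apply: sep; try exact: ds.
  have /andP[a1 a2] := truncn_itv (k0 g gs); have /andP[b1 b2] := truncn_itv (k0 h hs).
  rewrite -/(k _) e in a1 a2; rewrite -/(k _) in b1 b2.
  rewrite -[k h]/(k h) in a2 b2; rewrite -natr1 in a2 b2.
  have : `|(ev g - z) / delta - (ev h - z) / delta| < 1.
    by rewrite ltr_norml; apply/andP; split; lra.
  rewrite -mulrBl normrM normfV (gtr0_norm delta_gt0) ltr_pdivrMr // mul1r.
  by rewrite opprB addrA subrK.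
rewrite -(size_map k) -(size_iota 0 (Num.truncn (p ^+ 2 / delta)).+1).
apply: uniq_leq_size => // n /mapP[g gs ->].
rewrite mem_iota add0n /= ltnS; apply: le_truncn.
rewrite ler_pM2r ?invr_gt0 //; have /andP[_ h] := itv g gs; lra.
Qed.

Lemma max_config : exists z s, config z s /\
  forall z' s', config z' s' -> (size s' <= size s)%N.
Proof.
pose Q n := `[< exists z s, config z s /\ size s = n >].
have exQ : exists n, Q n.
  by exists 0%N; apply/asboolP; exists 0, [::]; split=> //; split.
have [||n /asboolP[z [s [c sn]]] mx] := @ex_maxnP Q (Num.truncn (p ^+ 2 / delta)).+1.
- by [].
- by move=> n /asboolP[z [s [c <-]]]; apply: config_size c.
exists z, s; split=> // z' s' c'; rewrite sn; apply: mx.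
by apply/asboolP; exists z', s'.
Qed.

(* Otherwise [V] and the translated window together would beat the maximum. *)
Lemma max_config_window z s n0 (U V : {poly int}) :
  config z s -> (forall z' s', config z' s' -> (size s' <= size s)%N) ->
  (forall g, g \in s -> (size g <= 4 * n0)%N) -> digits offT U -> digits offT V ->
  0 <= ev U ->
  ev U * P ^+ n0 + z <= ev V <= ev U * P ^+ n0 + z + p ^+ 2 ->
  exists2 g, g \in s & ev V = ev U * P ^+ n0 + ev g.
Proof.
move=> [z0 ds itv us] mx sz dU dV U0 hV; apply: contrapT => no.
pose s' := V :: [seq g + U * 'X^(4 * n0) | g <- s].
have c' : config (ev U * P ^+ n0 + z) s'.
  split.
  - by rewrite addr_ge0 // mulr_ge0 // exprn_ge0 // ltW.
  - move=> g; rewrite inE => /orP[/eqP->//|/mapP[h hs ->]].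
    by apply: digits_cat; [exact: sz | exact: ds | ].
  - move=> g; rewrite inE => /orP[/eqP->//|/mapP[h hs ->]].
    by rewrite pevalD ev_mulX4n; have /andP[h1 h2] := itv h hs; apply/andP; split; lra.
  - have E : map ev [seq g + U * 'X^(4 * n0) | g <- s]
           = map (fun x => x + ev U * P ^+ n0) (map ev s).
      by rewrite -!map_comp; apply: eq_map => g /=; rewrite pevalD ev_mulX4n.
    rewrite /= E map_inj_uniq ?us ?andbT; last exact: addIr.
    apply/negP => /mapP[x /mapP[g gs ->]] e; apply: no.
    by exists g => //; rewrite e addrC.
by have := mx _ _ c'; rewrite /= size_map ltnn.
Qed.

Lemma digits_ev_ge0 a H : digits a H -> 0 <= ev H.
Proof.
move=> [h _]; rewrite /peval horner_coef; apply: sumr_ge0 => i _.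
rewrite coef_map /=; apply: mulr_ge0; last by rewrite exprn_ge0 // ltW.
by case: (h i) => ->; rewrite ?ler01.
Qed.

(** A difference [ev U - ev V] is completed by digits on residue 2 until [max_config_window]
    applies. It is then determined by a polynomial of bounded size and a member of the maximal
    configuration. *)
Lemma finite_bounded_trits (K : R) : K * (P - 1) < p ^+ 2 ->
  finite_set [set y | exists2 H, trits offT H & y = ev H /\ `|y| <= K].
Proof.
move=> hK; have P1 := pow4_gt1.
have [z [s [cfg mx]]] := max_config.
have [z0 ds itv us] := cfg.
have [n1 hn1] := geom_unbounded (z / p ^+ 2).
pose n0 := maxn n1 (\max_(g <- s) size g).
have sz g : g \in s -> (size g <= 4 * n0)%N.
  move=> gs; apply: (@leq_trans n0); last by rewrite leq_pmull.
  by apply: leq_trans (leq_maxr _ _); exact: (@leq_bigmax_seq _ _ predT).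
have p2 : 0 < p ^+ 2 by rewrite exprn_gt0.
have zn0 : z <= p ^+ 2 * geom n0.
  rewrite mulrC -ler_pdivrMr //; apply: le_trans hn1 _.
  have hn : (n1 <= n0)%N by apply: leq_maxl.
  rewrite -(subnKC hn) geomD lerDr.
  by rewrite mulr_ge0 ?geom_ge0 // exprn_ge0 // ltW.
(* The hypothesis on [K] makes [p^2 - K (P - 1)] positive. For this [k] the full digits on residue
   2, worth [p^2 geom k], outweigh [K P^k]. *)
have [k hk] := pow4_unbounded (p ^+ 2 / (p ^+ 2 - K * (P - 1))).
have Kk : K * P ^+ k <= p ^+ 2 * geom k.
  rewrite ler_pdivrMr ?subr_gt0 // in hk.
  have h : 0 < P - 1 by rewrite subr_gt0.
  rewrite -(ler_pM2l h) [leRHS]mulrCA geomE.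
  by move: hk; move: (P ^+ k) (P - 1) => x y; lra.
have [e [de se Ee]] := full_residue2 k.
pose N := (4 * (n0 + k))%N.
pose E := [set (ev xy.1 - p ^+ 2 * geom k * P ^+ n0 - ev xy.2) / P ^+ (n0 + k) |
  xy in [set H : {poly int} | height_le 1 H /\ (size H <= N)%N] `*` [set` s]].
have finE : finite_set E.
  by apply: finite_image; apply: finite_setX => //; apply: finite_bounded_polys.
have key (U V : {poly int}) : digits offT U -> digits offT V -> ev U <= ev V ->
    ev V - ev U <= K -> E (ev U - ev V).
  move=> dU dV UV hUV.
  (* The target for [h] that puts [h + V X^(4(n0+k))] into the window translated by [e + U X^(4k)].
     It is nonnegative by [Kk] and within reach by [zn0]. *)
  pose v := (ev U - ev V) * P ^+ (n0 + k) + p ^+ 2 * geom k * P ^+ n0 + z.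
  have Pn : 0 <= P ^+ n0 by rewrite exprn_ge0 // ltW.
  have Pk : 0 <= P ^+ k by rewrite exprn_ge0 // ltW.
  have [||h [dh sh /andP[h1 h2]]] := @fill_residue 2 (n0 + k) v => //.
    apply/andP; split.
      rewrite /v addr_ge0 // exprD mulrCA [_ * P ^+ n0]mulrC -mulrDr mulr_ge0 //.
      have : (ev V - ev U) * P ^+ k <= K * P ^+ k by rewrite ler_wpM2r.
      move=> le_K; rewrite -[ev U - ev V]opprB mulNr addrC subr_ge0.
      exact: le_trans Kk.
    rewrite geomD mulrDr /v.
    have : (ev U - ev V) * P ^+ (n0 + k) <= 0.
      by rewrite mulr_le0_ge0 ?subr_le0 // exprn_ge0 // ltW.
    have -> : p ^+ 2 * (P ^+ n0 * geom k) = p ^+ 2 * geom k * P ^+ n0.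
      by rewrite mulrCA mulrC.
    by move=> le0; rewrite -addrA -[leRHS]add0r lerD // lerD2l.
  have dh' : digits offT h by apply: digitsW dh => r /= /eqP ->.
  have dUe : digits offT (e + U * 'X^(4 * k)) by apply: digits_cat.
  have dVh : digits offT (h + V * 'X^(4 * (n0 + k))) by apply: digits_cat.
  have EU : ev (e + U * 'X^(4 * k)) = p ^+ 2 * geom k + ev U * P ^+ k.
    by rewrite pevalD ev_mulX4n Ee.
  have EV : ev (h + V * 'X^(4 * (n0 + k))) = ev h + ev V * P ^+ (n0 + k).
    by rewrite pevalD ev_mulX4n.
  have [||g gs] := max_config_window cfg mx sz dUe dVh.
  - exact: digits_ev_ge0 dUe.
  - rewrite EU EV mulrDl -[ev U * _ * _]mulrA -exprD [(k + n0)%N]addnC.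
    move: h1 h2; rewrite /v mulrBl.
    move: (ev U * _) (ev V * _) (p ^+ 2) (p ^+ 2 * _ * _) (ev h).
    by clear=> *; apply/andP; split; lra.
  rewrite EU EV mulrDl -[ev U * _ * _]mulrA -exprD [(k + n0)%N]addnC => e1.
  exists (h, g) => /=; first by split=> //; split=> //; apply: zero_one_height; case: dh.
  apply: (@mulIf _ (P ^+ (n0 + k))); first by rewrite expf_neq0 // gt_eqF.
  rewrite mulfVK ?expf_neq0 ?gt_eqF // mulrBl.
  move: e1; move: (ev U * _) (ev V * _) (p ^+ 2 * _ * _) (ev h) (ev g).
  by clear=> *; lra.
apply: (@sub_finite_set _ _ (E `|` [set - y | y in E])); last first.
  by rewrite finite_setU; split=> //; apply: finite_image.
move=> y [H tH [-> hy]]; have [U [V [dU dV eH]]] := trits_sub tH.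
move: hy; rewrite eH pevalB ler_norml => /andP[b1 b2].
have [le|lt] := lerP (ev U) (ev V); first by left; apply: key => //; lra.
right; exists (ev V - ev U); last by rewrite opprB.
by apply: key => //; lra.
Qed.

End Separated.
End FiniteType.

(** * From digit sums to all bounded heights *)

Section FiniteTranslates.
Variable R : realType.
Implicit Types U V W : set R.

Definition sumset U V : set R := [set x | exists u v, [/\ U u, V v & x = u + v]].

(** Inclusion up to finitely many translations, a preorder compatible with sumsets. *)
Definition finitely_covered U V := exists2 F, finite_set F & U `<=` sumset F V.

Lemma finite_sumset U V : finite_set U -> finite_set V -> finite_set (sumset U V).
Proof.
move=> fU fV; apply: (@sub_finite_set _ _ ((fun xy => xy.1 + xy.2) @` (U `*` V))).
  by move=> _ [u [v [Uu Vv ->]]]; exists (u, v).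
by apply: finite_image; apply: finite_setX.
Qed.

Lemma finitely_covered_trans V U W :
  finitely_covered U V -> finitely_covered V W -> finitely_covered U W.
Proof.
move=> [F fF UF] [G fG VG]; exists (sumset F G); first exact: finite_sumset.
move=> u /UF [f [v [Ff /VG [g [w [Gg Ww ->]]] ->]]].
by exists (f + g), w; rewrite addrA; split=> //; exists f, g.
Qed.

Lemma finitely_covered_sub U V : U `<=` V -> finitely_covered U V.
Proof.
move=> UV; exists [set 0]; first exact: finite_set1.
by move=> u /UV Vu; exists 0, u; rewrite add0r.
Qed.

Lemma finitely_covered_sum U V U' V' : finitely_covered U V -> finitely_covered U' V' ->
  finitely_covered (sumset U U') (sumset V V').
Proof.
move=> [F fF UF] [G fG VG]; exists (sumset F G); first exact: finite_sumset.
move=> _ [_ [_ [/UF [f [v [Ff Vv ->]]] /VG [g [w [Gg Ww ->]]] ->]]].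
exists (f + g), (v + w); rewrite addrACA; split=> //; first by exists f, g.
by exists v, w.
Qed.

End FiniteTranslates.

Section Spectra.
Variable (R : realType) (p : R).
Hypothesis p_gt1 : 1 < p.
Hypothesis p4_lt2 : p ^+ 4 < 2.
Local Notation P := (p ^+ 4).
Local Notation ev := (peval p).
Hypothesis fin : forall K, K * (P - 1) < p ^+ 2 ->
  finite_set [set y | exists2 H, trits offT H & y = ev H /\ `|y| <= K].
Let p0 : 0 < p. Proof. exact: lt_trans ltr01 p_gt1. Qed.
Let P0 : 0 < P. Proof. by rewrite exprn_gt0. Qed.

Definition trit_values (a : pred nat) : set R := [set y | exists2 H, trits a H & y = ev H].
Local Notation T := trit_values.

Lemma trits_add_disjoint (a b c : pred nat) H H' : (forall r, ~~ (a r && b r)) ->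
  (forall r, a r || b r -> c r) -> trits a H -> trits b H' -> trits c (H + H').
Proof.
move=> dis sub [h s] [h' s']; split.
  move=> i; rewrite coefD; have := dis (i %% 4)%N; rewrite negb_and => /orP[/s->|/s'->].
    by rewrite add0r.
  by rewrite addr0.
by apply: supp4D; [apply: supp4W s | apply: supp4W s'] => r hr; apply: sub; rewrite hr ?orbT.
Qed.

Lemma trits_opp a H : trits a H -> trits a (- H).
Proof. by move=> [h s]; split; [move=> i; rewrite coefN normrN | exact: supp4N]. Qed.

Lemma approx_trits j y : (j < 3)%N -> exists2 a, trits (pred1 j) a & `|y - ev a| <= p ^+ 2.
Proof.
move=> j3.
have pos v : 0 <= v -> exists2 a, trits (pred1 j) a & `|v - ev a| <= p ^+ 2.
  move=> v0; have pj : 0 < p ^+ j by rewrite exprn_gt0.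
  have [n hn] := geom_unbounded p_gt1 (v / p ^+ j).
  have [||H [[z s] sH /andP[h1 h2]]] := @fill_residue _ p p_gt1 p4_lt2 j n v; first by lia.
    by rewrite v0 /= mulrC -ler_pdivrMr.
  exists H; first by split=> //; apply: zero_one_height.
  rewrite ler0_norm ?subr_le0 // opprB.
  have : p ^+ j <= p ^+ 2 by rewrite ler_eXn2l.
  by move: h2; lra.
have [y0|y0] := lerP 0 y; first exact: pos.
have [|a ta ha] := pos (- y); first by rewrite oppr_ge0 ltW.
exists (- a); first exact: trits_opp.
by rewrite pevalN -normrN opprB addrC.
Qed.

Lemma sqr_mulB1_lt : p ^+ 2 * (P - 1) < p ^+ 2.
Proof. by rewrite gtr_pMr ?exprn_gt0 // ltrBlDr. Qed.

(** Subtracting from [H] an approximation on the free residue [k] leaves a trit sum on residues 0,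
    1, 2 of modulus at most [p^2]. By [fin] and [P < 2] only finitely many of these occur. *)
Lemma trits_move (a : pred nat) k : (k < 3)%N -> (forall r, a r -> (r < 3)%N && (r != k)) ->
  finitely_covered (T a) (T (pred1 k)).
Proof.
move=> k3 ak; eexists; first exact: fin sqr_mulB1_lt.
move=> _ [H tH ->]; have [b tb hb] := approx_trits (ev H) k3.
exists (ev H - ev b), (ev b); split; rewrite ?subrK //; last by exists b.
exists (H - b); last by rewrite pevalB.
apply: (@trits_add_disjoint a (pred1 k)); last exact: trits_opp.
- by move=> r; apply/negP => /andP[/ak /andP[_ /negP]].
- by move=> r /orP[/ak /andP[] | /= /eqP ->]; rewrite /offT; lia.
- by [].
Qed.

Lemma sumset_trits (a b c : pred nat) : (forall r, ~~ (a r && b r)) ->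
  (forall r, a r || b r -> c r) -> sumset (T a) (T b) `<=` T c.
Proof.
move=> dis sub _ [_ [_ [[H tH ->] [H' tH' ->] ->]]].
by exists (H + H'); rewrite ?pevalD //; apply: trits_add_disjoint dis sub tH tH'.
Qed.

Lemma trit_values_cover1 i j : (i < 3)%N -> (j < 3)%N -> i != j ->
  finitely_covered (T (pred1 i)) (T (pred1 j)).
Proof. by move=> i3 j3 ij; apply: trits_move => // r /= /eqP ->; rewrite i3. Qed.

Lemma trit_values_cover2 i j k :
  (i < 3)%N -> (j < 3)%N -> (k < 3)%N -> i != j -> i != k -> j != k ->
  finitely_covered (sumset (T (pred1 i)) (T (pred1 j))) (T (pred1 k)).
Proof.
move=> i3 j3 k3 ij ik jk; apply: (@finitely_covered_trans _ (T (pred2 i j))).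
  apply/finitely_covered_sub/sumset_trits => // r /=; apply/negP => /andP[/eqP-> /eqP e].
  by rewrite e eqxx in ij.
by apply: trits_move => // r /= /orP[] /eqP ->; apply/andP.
Qed.

(** Residues 3 and 1 are residues 2 and 0 shifted by [X], so the cover of residue 2 by residue 0 is
    multiplied by [p]. *)
Lemma trit_values_cover3 : finitely_covered (T (pred1 3)) (T (pred1 1)).
Proof.
have [F fF sub] := @trit_values_cover1 2 0 isT isT isT.
exists [set p * f | f in F]; first exact: finite_image.
move=> _ [H [h s] ->].
have e : H = drop_poly 1 H * 'X.
  rewrite -{1}(poly_take_drop 1 H) expr1; suff -> : take_poly 1 H = 0 by rewrite add0r.
  apply/polyP => i; rewrite coef_take_poly coef0; case: i => //=.
  by rewrite s.
have [|f [_ [Ff [G [g sg] ->] E]]] := sub (ev (drop_poly 1 H)).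
  exists (drop_poly 1 H) => //; split=> i; rewrite coef_drop_poly //.
  by move=> /= i2; apply: s => /=; lia.
exists (p * f), (ev (G * 'X)); split; first by exists f.
  exists (G * 'X) => //; split=> i; first by rewrite coefMX; case: eqP.
  by rewrite coefMX => /= i1; case: eqP => // i0; apply: sg => /=; lia.
by rewrite e !pevalM !pevalX E; ring.
Qed.

(** The second copy of residue 0 moves to residue 1, both merge into residue 2, and this returns to
    residue 0. *)
Lemma trit_values_cover00 :
  finitely_covered (sumset (T (pred1 0%N)) (T (pred1 0%N))) (T (pred1 0%N)).
Proof.
apply: (@finitely_covered_trans _ (sumset (T (pred1 0%N)) (T (pred1 1%N)))).
  by apply: finitely_covered_sum; [exact: finitely_covered_sub | exact: trit_values_cover1].
by apply: (@finitely_covered_trans _ (T (pred1 2)));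
  [exact: trit_values_cover2 | exact: trit_values_cover1].
Qed.

Definition height_values (m : nat) : set R := [set y | exists2 H, height_le m%:Z H & y = ev H].

(** The four residue parts are merged in turn: 0 and 1 into 2; 3 into 1, which joins 2 in 0; finally
    2 and 0 into 1, which moves to 0. *)
Lemma height1_values_cover : finitely_covered (height_values 1) (T (pred1 0%N)).
Proof.
apply: (@finitely_covered_trans _ (sumset (sumset (T (pred1 0%N)) (T (pred1 1%N)))
                                  (sumset (T (pred1 2)) (T (pred1 3))))).
  apply: finitely_covered_sub => _ [H h ->].
  pose c j : {poly int} := \poly_(i < size H) (if (i %% 4 == j)%N then H`_i else 0).
  have tc j : T (pred1 j) (ev (c j)).
    exists (c j) => //; split=> i; rewrite coef_poly; first by case: ifP => // _; case: ifP.
    by move=> /= /negbTE ->; rewrite if_same.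
  exists (ev (c 0%N) + ev (c 1%N)), (ev (c 2) + ev (c 3)); split.
  - by exists (ev (c 0%N)), (ev (c 1%N)).
  - by exists (ev (c 2)), (ev (c 3)).
  rewrite -!pevalD; congr (ev _); apply/polyP => i.
  rewrite !coefD !coef_poly; case: ltnP => hi; last by rewrite nth_default.
  have : (i %% 4 < 4)%N by rewrite ltn_mod.
  by case: (i %% 4)%N => [|[|[|[|]]]] //= _; rewrite ?addr0 ?add0r.
apply: (@finitely_covered_trans _ (sumset (T (pred1 2)) (T (pred1 0%N)))); last first.
  by apply: (@finitely_covered_trans _ (T (pred1 1%N)));
    [exact: trit_values_cover2 | exact: trit_values_cover1].
apply: finitely_covered_sum; first exact: trit_values_cover2.
apply: (@finitely_covered_trans _ (sumset (T (pred1 2)) (T (pred1 1%N))));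
  last exact: trit_values_cover2.
by apply: finitely_covered_sum; [exact: finitely_covered_sub | exact: trit_values_cover3].
Qed.

Lemma height_values_cover m : finitely_covered (height_values m) (T (pred1 0%N)).
Proof.
elim: m => [|m IH].
  apply: finitely_covered_sub => _ [H h ->]; exists H => //; split=> [i|i _].
    by apply: le_trans (h i) _.
  by apply/eqP; rewrite -normr_le0 h.
apply: finitely_covered_trans trit_values_cover00.
apply: finitely_covered_trans (finitely_covered_sum IH height1_values_cover).
apply: finitely_covered_sub => _ [H h ->].
(* Removing the sign of each coefficient lowers the height by one. *)
pose G : {poly int} := \poly_(i < size H) sgz (H`_i).
have GE i : G`_i = sgz H`_i.
  by rewrite coef_poly; case: ltnP => // hi; rewrite nth_default.
exists (ev (H - G)), (ev G); rewrite -pevalD subrK; split=> //.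
  exists (H - G) => // i; rewrite coefB GE; have := h i.
  by move: H`_i => z; rewrite /sgz; case: (ltgtP z 0) => hz; lia.
by exists G => // i; rewrite GE; move: H`_i => z; rewrite /sgz; case: (ltgtP z 0) => hz; lia.
Qed.

Lemma ev_trits_bound n H : trits (pred1 0%N) H -> (size H <= 4 * n)%N -> `|ev H| <= geom p n.
Proof.
elim: n H => [|n IH] H [h s] sz.
  have -> : H = 0 by apply/size_poly_leq0P; rewrite muln0 in sz.
  by rewrite peval0 normr0 geom_ge0.
have e : H = (H`_0)%:P + drop_poly 4 H * 'X^(4 * 1).
  rewrite -{1}(poly_take_drop 4 H); congr (_ + _); apply/polyP => i.
  rewrite coef_take_poly coefC; case: ltnP => hi; last by case: eqP hi => // ->.
  by case: eqP => [->//|i0]; apply: s => /=; rewrite modn_small //; apply/eqP.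
rewrite e pevalD pevalC ev_mulX4n expr1 geomS.
apply: le_trans (ler_normD _ _) _; rewrite addrC lerD //; last first.
  by rewrite -intr_norm (le_trans (_ : _ <= 1%:~R)) // ler_int h.
rewrite normrM (ger0_norm (ltW P0)) mulrC ler_wpM2l ?(ltW P0) //; apply: IH.
  split=> i; rewrite coef_drop_poly //.
  by move=> i0; apply: s; rewrite modnDr.
by rewrite size_drop_poly; lia.
Qed.

Lemma finite_trits0 L : finite_set [set y | T (pred1 0%N) y /\ `|y| <= L].
Proof.
have P1 : 0 < P - 1 by rewrite subr_gt0 exprn_egt1.
have pp : 0 < p - 1 by rewrite subr_gt0.
(* For this [k] the quotient of [H] by [X^(4k)] has value at most
   [(L + geom k) / P^k <= p / (P - 1)], a bound within [fin] since [p < p^2]. The part of lower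
   degree has finitely many values. *)
have [k hk] := pow4_unbounded p_gt1 (L * (P - 1) / (p - 1)).
have Pk : 0 < P ^+ k by rewrite exprn_gt0.
pose F := [set y | exists2 H, trits offT H & y = ev H /\ `|y| <= p / (P - 1)].
have fF : finite_set F.
  by apply: fin; rewrite divfK ?gt_eqF // ltr_eXnr.
pose G := ev @` [set H : {poly int} | height_le 1 H /\ (size H <= 4 * k)%N].
have fG : finite_set G by apply/finite_image/finite_bounded_polys.
apply: (@sub_finite_set _ _ (sumset G [set P ^+ k * f | f in F])); last first.
  by apply: finite_sumset => //; apply: finite_image.
move=> _ [[H [h s] ->] hL].
have e := poly_take_drop (4 * k) H.
have tk : trits (pred1 0%N) (take_poly (4 * k) H).
  split=> i; rewrite coef_take_poly; first by case: ifP.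
  by move=> i0; rewrite s // if_same.
have td : trits (pred1 0%N) (drop_poly (4 * k) H).
  split=> i; rewrite coef_drop_poly //.
  by move=> i0; apply: s; rewrite -modnDmr modnMr addn0.
exists (ev (take_poly (4 * k) H)), (P ^+ k * ev (drop_poly (4 * k) H)); split.
- by exists (take_poly (4 * k) H) => //; split; [case: tk | exact: size_take_poly].
- exists (ev (drop_poly (4 * k) H)) => //; exists (drop_poly (4 * k) H).
    by case: td => td1 td2; split=> //; apply: supp4W td2 => r /= /eqP ->.
  split=> //; have E : ev (drop_poly (4 * k) H) * P ^+ k = ev H - ev (take_poly (4 * k) H).
    by rewrite -ev_mulX4n -pevalB; congr (ev _); rewrite -[X in X - _]e addrC addKr.
  rewrite ler_pdivlMr // -(ler_pM2r Pk) mulrAC -[P ^+ k in leLHS](gtr0_norm Pk) -normrM E.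
  have : `|ev H - ev (take_poly (4 * k) H)| <= L + geom p k.
    apply: le_trans (ler_normB _ _) _; apply: lerD => //.
    by apply: ev_trits_bound => //; apply: size_take_poly.
  move=> /(ler_wpM2r (ltW P1)).
  rewrite (mulrDl L) [geom p k * _]mulrC geomE => h1; apply: le_trans h1 _.
  by move: hk; rewrite ler_pdivrMr // => hk; move: hk; move: (P ^+ k) => x; lra.
by rewrite -{1}e pevalD ev_mulX4n; congr (_ + _); rewrite mulrC.
Qed.

Lemma finite_spectrum m L : finite_set (spectrum p m L).
Proof.
have [F fF sub] := height_values_cover `|m|%N.
pose B f := [set f + v | v in [set y | T (pred1 0%N) y /\ `|y| <= L + `|f|]].
apply: (@sub_finite_set _ _ (\bigcup_(f in F) B f)); last first.
  by apply: bigcup_finite => // f _; apply/finite_image/finite_trits0.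
move=> y [H h [yE yL]].
have [|f [v [Ff Tv E]]] := sub y.
  by exists H => // i; apply: le_trans (h i) _; lia.
exists f => //; exists v => //; split=> //.
have -> : v = y - f by rewrite E addrC addKr.
by apply: le_trans (ler_normB _ _) _; rewrite lerD.
Qed.

End Spectra.

Lemma small_digit_differences (R : realType) (p delta : R) :
  1 < p -> p ^+ 4 < 2 -> 0 < delta ->
  exists U V, [/\ digits offT U, digits offT V & 0 < peval p U - peval p V < delta].
Proof.
move=> p1 p4 d0; apply: contrapT => no.
have sep (H H' : {poly int}) : digits offT H -> digits offT H' ->
    `|peval p H - peval p H'| < delta -> peval p H = peval p H'.
  move=> dH dH' h; apply: contrapT => ne; apply: no.
  have [lt|lt|//] := ltgtP (peval p H) (peval p H').
    exists H', H; split=> //; rewrite subr_gt0 lt /=.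
    by move: h; rewrite distrC gtr0_norm // subr_gt0.
  exists H, H'; split=> //; rewrite subr_gt0 lt /=.
  by move: h; rewrite gtr0_norm // subr_gt0.
have ft := finite_bounded_trits p1 p4 d0 sep.
(* Here [(5/4)^4 = 625/256] exceeds 2. *)
have p54 : p < 5 / 4.
  rewrite ltNge; apply/negP => h; move: p4; apply/negP; rewrite -leNgt.
  have h2 : 25 / 16 <= p ^+ 2 by nra.
  by rewrite (exprM p 2 2); nra.
by apply: (spectrum_not_finite p1 _ (finite_spectrum p1 p4 ft) p54); lra.
Qed.

(** * Density of orbits and universal digit sequences *)

Section Density.
Variable (R : realType) (p : R).
Hypothesis p_gt1 : 1 < p.
Hypothesis p4_lt2 : p ^+ 4 < 2.
Local Notation P := (p ^+ 4).
Local Notation ev := (peval p).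
Let p0 : 0 < p. Proof. exact: lt_trans ltr01 p_gt1. Qed.
Let P0 : 0 < P. Proof. by rewrite exprn_gt0. Qed.

(** A difference below [eta / P^N] is shifted past the first [4 N] positions and then multiplied by
    [P] until it first exceeds [eta / 2]; as [P < 2], it does not jump over [eta]. *)
Lemma scaled_difference (eta : R) N : 0 < eta ->
  exists U V, [/\ digits offT U, digits offT V &
    eta / 2 < ev (U * 'X^(4 * N)) - ev (V * 'X^(4 * N)) <= eta].
Proof.
move=> eta0; have P2 := p4_lt2.
have PN : 0 < P ^+ N by rewrite exprn_gt0.
have [U [V [dU dV /andP[h0 h1]]]] := small_digit_differences p_gt1 p4_lt2 (divr_gt0 eta0 PN).
set y := (ev U - ev V) * P ^+ N.
have y0 : 0 < y by rewrite mulr_gt0.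
have y1 : y < eta by rewrite -ltr_pdivlMr.
have ex : exists k, eta / 2 < y * P ^+ k.
  have [k hk] := pow4_unbounded p_gt1 (eta / y); exists k.
  rewrite [ltRHS]mulrC -ltr_pdivrMr //; apply: lt_le_trans hk.
  by rewrite ltr_pM2r ?invr_gt0 //; lra.
case: (ex_minnP ex) => k hk mk.
exists (U * 'X^(4 * k)), (V * 'X^(4 * k)); split; try exact: digits_mulX4n.
rewrite !ev_mulX4n -!mulrBl mulrAC -/y hk /=.
case: k hk mk => [|k] hk mk; first by rewrite expr0 mulr1 ltW.
have hk' : y * P ^+ k <= eta / 2 by rewrite leNgt; apply/negP => /mk; rewrite ltnn.
rewrite exprS mulrCA; apply: (@le_trans _ _ (P * (eta / 2))).
  by rewrite ler_pM2l.
by nra.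
Qed.

(** Each new pair [U], [V] sits above all earlier digits: adding [V] to every earlier term keeps the
    increments, and [U] in place of [V] on the last term creates one more. *)
Lemma difference_chain (eta : R) M : 0 < eta -> exists N (f : nat -> {poly int}),
  [/\ forall m, digits offT (f m) /\ (size (f m) <= 4 * N)%N &
      forall m, (m < M)%N -> eta / 2 < ev (f m.+1) - ev (f m) <= eta].
Proof.
move=> eta0; elim: M => [|M [N [f [hf df]]]].
  by exists 0%N, (fun=> 0); split=> // m; split; [exact: digits0 | rewrite size_poly0].
have [U [V [dU dV hUV]]] := scaled_difference N eta0.
have cat m W : digits offT W -> digits offT (f m + W * 'X^(4 * N)).
  by move=> dW; apply: digits_cat => //; case: (hf m).
exists (N + maxn (size U) (size V))%N.
exists (fun m => if (m <= M)%N then f m + V * 'X^(4 * N) else f M + U * 'X^(4 * N)); split.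
  move=> m; split; first by case: ifP => _; apply: cat.
  have sz k (W : {poly int}) : (size W <= maxn (size U) (size V))%N ->
      (size (f k + W * 'X^(4 * N))%R <= 4 * (N + maxn (size U) (size V)))%N.
    move=> sW; apply/leq_sizeP => j hj; rewrite coefD coefMXn.
    have [_ sk] := hf k; rewrite nth_default ?add0r; last by apply: leq_trans sk _; lia.
    by case: ltnP => // hj'; rewrite nth_default // (leq_trans sW) //; lia.
  by case: ifP => _; apply: sz; rewrite leq_max leqnn ?orbT.
move=> m hm; have [->|mM] : m = M \/ (m < M)%N by lia.
  by rewrite /= leqnn ltnn !pevalD; move: hUV; rewrite opprD addrACA subrr add0r.
by rewrite /= mM ltnW // !pevalD opprD addrACA subrr addr0; apply: df.
Qed.

(** Digits on residue 3 bring the value into [[b, b + p^3]]. The chain then lowers it by steps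
    between [eta / 2] and [eta = (b - a) / 2], over a total length above [p^3], so the first value
    below [b] is still above [a]. *)
Lemma orbit_density (r a b : R) : 0 < r <= 1 -> 0 <= a -> a < b ->
  exists n H, [/\ zero_one H, (size H <= n)%N & a < p ^+ n * r - ev H < b].
Proof.
move=> /andP[r0 r1] a0 ab; have P2 := p4_lt2; have P1 := pow4_gt1 p_gt1.
pose eta := (b - a) / 2.
have eta0 : 0 < eta by rewrite divr_gt0 ?subr_gt0.
pose M := (Num.truncn (p ^+ 3 / (eta / 2))).+1.
have hM : p ^+ 3 < M%:R * (eta / 2).
  by have := truncnS_gt (p ^+ 3 / (eta / 2)); rewrite ltr_pdivrMr // divr_gt0.
have [N [f [hf df]]] := difference_chain M eta0.
pose B := ev (f 0%N).
have B0 : 0 <= B by apply: digits_ev_ge0 (hf 0%N).1.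
have p3 : 0 < p ^+ 3 by rewrite exprn_gt0.
have [k hk] := pow4_unbounded p_gt1 ((B + b + p ^+ 3) / r).
pose n := (N + k)%N.
have Pn1 j : 1 <= P ^+ j by rewrite exprn_ege1 // ltW.
have hn : B + b + p ^+ 3 <= P ^+ n * r.
  move: hk; rewrite ler_pdivrMr // => /le_trans; apply.
  rewrite ler_wpM2r ?(ltW r0) // exprD ler_peMl // (le_trans ler01) //.
have [||t [dt st /andP[t1 t2]]] :=
    @fill_residue _ p p_gt1 p4_lt2 3 n (P ^+ n * r - B - b - p ^+ 3) => //.
  apply/andP; split; first by lra.
  have g1 : P ^+ n - 1 <= geom p n.
    by rewrite -geomE ler_piMl ?geom_ge0 //; lra.
  have g2 : p ^+ 3 * (P ^+ n - 1) <= p ^+ 3 * geom p n by rewrite ler_pM2l.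
  have g3 : P ^+ n * r <= P ^+ n by rewrite ler_piMr // (le_trans ler01).
  have g4 : P ^+ n <= p ^+ 3 * P ^+ n.
    by rewrite ler_peMl ?(le_trans ler01) // exprn_ege1 // ltW.
  by move: g1 g2 g3 g4; rewrite mulrBr mulr1; move: (P ^+ n) (p ^+ 3 * geom p n) => x z; lra.
pose v m := P ^+ n * r - ev (f m) - ev t.
have v0 : b <= v 0%N <= b + p ^+ 3 by rewrite /v -/B; apply/andP; split; lra.
have vm m : (m <= M)%N -> v m <= v 0%N - m%:R * (eta / 2).
  elim: m => [|m IH] mM; first by rewrite mul0r subr0.
  have := IH (ltnW mM); have /andP[h _] := df m mM.
  by rewrite /v -[m.+1%:R]natr1 mulrDl mul1r; lra.
have ex : exists m, (m <= M)%N && (v m < b).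
  exists M; rewrite leqnn /=; apply: le_lt_trans (vm M (leqnn _)) _.
  by move/andP: v0 => [_]; lra.
case: (ex_minnP ex) => m /andP[mM vb] mm.
exists (4 * n)%N, (f m + t); split.
- apply: zero_one_disjoint; [by case: (hf m) => -[] | by case: dt |].
  move=> i; case: (eqVneq (i %% 4)%N 3%N) => e.
    by left; have [[_ s] _] := hf m; apply: s; rewrite /offT e.
  by right; have [_ s] := dt; apply: s.
- apply: leq_trans (size_polyD _ _) _; rewrite geq_max st andbT.
  by apply: leq_trans (hf m).2 _; rewrite leq_mul2l leq_addr.
rewrite exprM pevalD opprD addrA -/(v m) vb andbT.
case: m mM vb mm => [|m] mM vb mm; first by move/andP: v0 => [h _]; lra.
have : b <= v m.
  rewrite leNgt; apply/negP => h; have := mm m; rewrite (ltnW mM) h => /(_ isT).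
  by rewrite ltnn.
have /andP[_ h] := df m mM; move: h; rewrite /v /eta; lra.
Qed.

End Density.

(** * Words that keep an orbit inside the interval *)

Section Words.
Variable (R : realType) (p : R).
Hypothesis p_gt1 : 1 < p.
Let p0 : 0 < p. Proof. exact: lt_trans ltr01 p_gt1. Qed.

Definition remainder (r : R) (w : seq bool) : R := foldl (fun r (c : bool) => p * r - c%:R) r w.

Definition inner (r : R) := 0 < r < (p - 1)^-1.

Lemma remainder_cat r u v : remainder r (u ++ v) = remainder (remainder r u) v.
Proof. by rewrite /remainder foldl_cat. Qed.

Lemma remainder_rcons r u c : remainder r (rcons u c) = p * remainder r u - c%:R.
Proof. by rewrite -cats1 remainder_cat. Qed.

Lemma remainder_affine r w : remainder r w = p ^+ size w * r + remainder 0 w.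
Proof.
elim/last_ind: w => [|w c IH]; first by rewrite /= mul1r addr0.
by rewrite !remainder_rcons IH size_rcons exprS; ring.
Qed.

Lemma remainder_le0 r w : r <= 0 -> remainder r w <= 0.
Proof.
move=> r0; elim/last_ind: w => [//|w c IH]; rewrite remainder_rcons.
by rewrite subr_le0 (le_trans (_ : _ <= 0)) ?ler0n // pmulr_rle0.
Qed.

Lemma remainder_ge r w : (p - 1)^-1 <= r -> (p - 1)^-1 <= remainder r w.
Proof.
move=> r0; elim/last_ind: w => [//|w c IH]; rewrite remainder_rcons.
have P1 := p_gt1; have pp : 0 < p - 1 by rewrite subr_gt0.
have e : p * (p - 1)^-1 = (p - 1)^-1 + 1.
  by apply: (mulIf (lt0r_neq0 pp)); rewrite -mulrA mulrDl mulVf ?gt_eqF // mulr1 mul1r addrC subrK.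
have : p * (p - 1)^-1 <= p * remainder r w by rewrite ler_pM2l.
by rewrite e; case: c => /=; lra.
Qed.

(** Both sides of the complement of the open interval are invariant, so an orbit that leaves it
    never returns. *)
Lemma inner_prefix r u v : inner (remainder r (u ++ v)) -> inner (remainder r u).
Proof.
rewrite remainder_cat => /andP[h1 h2]; apply/andP; split; rewrite ltNge; apply/negP.
  by move/(remainder_le0 v); rewrite leNgt h1.
by move/(remainder_ge v); rewrite leNgt h2.
Qed.

(** The constant coefficient becomes the last letter, as in Horner's scheme. *)
Lemma poly_word n H : zero_one H -> (size H <= n)%N ->
  exists2 v, size v = n & forall r, remainder r v = p ^+ n * r - peval p H.
Proof.
elim: n H => [|n IH] H zH sH.
  exists [::] => // r; have -> : H = 0 by apply/size_poly_leq0P.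
  by rewrite peval0 mul1r subr0.
have e : H = drop_poly 1 H * 'X + (H`_0)%:P.
  rewrite -{1}(poly_take_drop 1 H) addrC expr1; congr (_ + _); apply/polyP => i.
  by rewrite coef_take_poly coefC; case: i.
have [||v sv hv] := IH (drop_poly 1 H).
- by move=> i; rewrite coef_drop_poly.
- by rewrite size_drop_poly; lia.
exists (rcons v (H`_0 == 1)); first by rewrite size_rcons sv.
move=> r; rewrite remainder_rcons hv [in RHS]e pevalD pevalM pevalX pevalC exprS.
have -> : (H`_0)%:~R = ((H`_0 == 1) : nat)%:R :> R by case: (zH 0%N) => ->.
by ring.
Qed.

(** Digit 1 multiplies the distance to its fixed point [1/(p - 1)] by [p]. Just before the first
    state at most 1 the state exceeds 1, so [p r - 1] is still positive. *)
Lemma reach_unit r : inner r -> exists u, 0 < remainder r u <= 1.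
Proof.
move=> /andP[r0 r1]; have P1 := p_gt1; have pp : 0 < p - 1 by rewrite subr_gt0.
pose d := (p - 1)^-1 - r.
have d0 : 0 < d by rewrite subr_gt0.
have e : (p - 1) * (p - 1)^-1 = 1 by rewrite divff ?gt_eqF.
have rk k : remainder r (nseq k true) = (p - 1)^-1 - p ^+ k * d.
  have -> : nseq k true = rev (nseq k true) by rewrite rev_nseq.
  elim: k => [|k IH]; first by rewrite /= mul1r /d opprB addrC subrK.
  rewrite /= rev_cons remainder_rcons IH exprS /=.
  have -> : p * ((p - 1)^-1 - p ^+ k * d) - 1 = (p - 1) * (p - 1)^-1 + (p - 1)^-1 - p * p ^+ k * d - 1
    by ring.
  by rewrite e addrAC [1 + _]addrC addrK.
have ex : exists k, remainder r (nseq k true) <= 1.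
  have pe : 1 < p ^+ 4 by rewrite exprn_egt1.
  have [k hk] := pow4_unbounded p_gt1 ((p - 1)^-1 / d); exists (4 * k)%N.
  rewrite rk exprM; move: hk; rewrite ler_pdivrMr //; lra.
case: (ex_minnP ex) => k hk mk; exists (nseq k true); rewrite hk andbT.
case: k hk mk => [//|k] hk mk.
have : 1 < remainder r (nseq k true).
  by rewrite ltNge; apply/negP => /mk; rewrite ltnn.
rewrite -[k.+1]addn1 nseqD cats1 remainder_rcons /=; nra.
Qed.

(** Reading [w] is an affine map; from a state in [(0, 1]], density reaches the preimage of the
    inner interval, whose left end is nonnegative. *)
Lemma extend_word r w : p ^+ 4 < 2 -> inner r -> exists v, inner (remainder r (v ++ w)).
Proof.
move=> p4 ir; have [u hu] := reach_unit ir.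
have pp : 0 < p - 1 by rewrite subr_gt0.
pose c := - remainder 0 w.
have c0 : 0 <= c by rewrite oppr_ge0 remainder_le0.
have pn : 0 < p ^+ size w by rewrite exprn_gt0.
have [||n [H [zH sH /andP[h1 h2]]]] :=
    orbit_density p_gt1 p4 hu (_ : 0 <= c / p ^+ size w)
      (_ : _ < (c + (p - 1)^-1) / p ^+ size w).
- by rewrite divr_ge0 // ltW.
- by rewrite ltr_pM2r ?invr_gt0 // ltrDl invr_gt0.
have [v sv hv] := poly_word zH sH.
exists (u ++ v); rewrite -catA !remainder_cat remainder_affine hv.
rewrite ltr_pdivrMr // in h1; rewrite ltr_pdivlMr // in h2.
rewrite /inner [p ^+ size w * _]mulrC; move: h1 h2; rewrite /c.
move: (_ * p ^+ size w) (remainder 0 w) => x y; lra.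
Qed.

Lemma word_enum : exists E : nat -> seq bool, forall w, exists n, E n = w.
Proof.
exists (fun n => odflt [::] (unpickle n)) => w; exists (pickle w).
by rewrite pickleK.
Qed.

Definition states (x : R) (c : nat -> bool) n := remainder x (mkseq c n).

Lemma states0 x c : states x c 0 = x.
Proof. by []. Qed.

Lemma statesS x c n : states x c n.+1 = p * states x c n - (c n)%:R.
Proof. by rewrite /states mkseqS remainder_rcons. Qed.

Lemma universal_states x : p ^+ 4 < 2 -> inner x -> exists c : nat -> bool,
  (forall n, inner (states x c n)) /\
  forall w : seq bool, exists n, mkseq (fun i => c (n + i)%N) (size w) = w.
Proof.
move=> p4 ix; have [E hE] := word_enum.
have ext (uw : seq bool * seq bool) : exists v, inner (remainder x uw.1) ->
    inner (remainder x (uw.1 ++ v ++ uw.2)).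
  case: (pselect (inner (remainder x uw.1))) => h; last by exists [::].
  have [v hv] := extend_word uw.2 p4 h; exists v => _.
  by rewrite remainder_cat.
have [v hv] := choice ext.
(* The extra letter makes [u k] grow even when [E k] is empty, so that every digit of [c] is
   eventually fixed. *)
pose W k := rcons (E k) true.
pose u := fix u k := if k is k.+1 then u k ++ v (u k, W k) ++ W k else [::].
have iu k : inner (remainder x (u k)).
  by elim: k => [|k IH] //=; exact: (hv (u k, W k)).
have su k : (k <= size (u k))%N.
  by elim: k => [|k IH] //=; rewrite !size_cat size_rcons; lia.
have pre k l : (k <= l)%N -> exists s, u l = u k ++ s.
  move=> kl; rewrite -(subnKC kl); elim: (l - k)%N => [|m [s IH]].
    by exists [::]; rewrite addn0 cats0.
  by rewrite addnS /= IH -catA; eexists.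
pose c i := nth false (u i.+1) i.
have cE k i : (i < size (u k))%N -> c i = nth false (u k) i.
  move=> ik; rewrite /c.
  have [s1 e1] := pre i.+1 _ (leq_maxl i.+1 k).
  have [s2 e2] := pre k _ (leq_maxr i.+1 k).
  have := congr1 (fun s => nth false s i) e1.
  by rewrite e2 !nth_cat ik (su i.+1) => ->.
have ck k n : (n <= size (u k))%N -> mkseq c n = take n (u k).
  move=> nk; apply: (@eq_from_nth _ false); first by rewrite size_mkseq size_takel.
  move=> i; rewrite size_mkseq => ni; rewrite nth_mkseq // nth_take //.
  by apply: cE; apply: leq_trans nk.
exists c; split.
  move=> n; rewrite /states (ck n n) ?su //.
  by apply: (@inner_prefix _ _ (drop n (u n))); rewrite cat_take_drop.
move=> w; have [k <-] := hE w.
exists (size (u k) + size (v (u k, W k)))%N.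
apply: (@eq_from_nth _ false); first by rewrite size_mkseq.
move=> i; rewrite size_mkseq => ni; rewrite nth_mkseq // (cE k.+1) /=; last first.
  by rewrite !size_cat size_rcons; lia.
rewrite !nth_cat; case: ltnP => h1; first by lia.
case: ltnP => h2; first by lia.
rewrite (_ : (_ - _ - _ = i)%N); last by lia.
by rewrite nth_rcons ni.
Qed.

End Words.

(** * Golden base and branching below it *)

Lemma pow_unbounded (R : realType) (p x : R) : 1 < p -> exists n, x < p ^+ n.
Proof.
move=> p1; have [k hk] := pow4_unbounded p1 (x + 1); exists (4 * k)%N.
by rewrite exprM (lt_le_trans _ hk) // ltrDl.
Qed.

Section Golden.
Variable (R : realType) (p : R).
Hypothesis p_gt1 : 1 < p.
Hypothesis p_golden : p ^+ 2 = p + 1.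

Let alt k := ~~ odd k.

(* 1010... up to position [n], where it is broken; afterwards the digits are forced. *)
Definition broken n k := if (k < n)%N then alt k else if k == n then odd k else alt n.

Lemma states_alt c n : (forall k, (k < n)%N -> c k = alt k) ->
  states p 1 c n = if odd n then p - 1 else 1.
Proof.
elim: n => [//|n IH] h; rewrite statesS IH => [|k kn]; last by apply: h; lia.
rewrite h //= /alt; case: (odd n) => /=; rewrite ?mulr1 ?subr0 //.
by have := p_golden; lra.
Qed.

(** The break leads to 0 or to [p = 1/(p - 1)], the fixed points of the digits 0 and 1. *)
Lemma states_after_break c n k : (forall k, (k < n)%N -> c k = alt k) -> c n = odd n ->
  (forall j, (n < j < n + k.+1)%N -> c j = alt n) ->
  states p 1 c (n + k.+1) = if odd n then 0 else p.
Proof.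
move=> h1 h2; have E := p_golden; elim: k => [|k IH] h3.
  rewrite addn1 statesS states_alt // h2; case: (odd n) => /=; rewrite ?mulr1 ?subr0 //.
  by lra.
rewrite addnS statesS IH => [|j hj]; last by apply: h3; lia.
rewrite h3; last by lia.
by rewrite /alt; case: (odd n) => /=; lra.
Qed.

Lemma golden_expansions c : (forall n, 0 <= states p 1 c n <= p) <->
  c = alt \/ exists n, c = broken n.
Proof.
have P1 := p_gt1; have E := p_golden; split=> [h|].
  case: (pselect (c = alt)) => [|ne]; [by left | right].
  have ex : exists n, c n != alt n.
    apply: contrapT => no; apply: ne; apply/funext => n.
    by apply/eqP; apply/negPn/negP => hn; apply: no; exists n.
  case: (ex_minnP ex) => n hn mn; exists n.
  have h1 k : (k < n)%N -> c k = alt k.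
    by move=> kn; apply/eqP; apply/negPn/negP => /mn; lia.
  have h2 : c n = odd n by move: hn; rewrite /alt; case: (c n); case: (odd n).
  have h3 k : forall j, (n < j < n + k)%N -> c j = alt n.
    elim: k => [|k IH] j hj; first by lia.
    have [lt|->] : (n < j < n + k)%N \/ j = (n + k)%N by lia.
      exact: IH.
    case: k IH hj => [|k] IH hj; first by lia.
    (* The other digit would lead from 0 to -1, or from [p] to [p^2 > p]. *)
    have := h (n + k.+1).+1; rewrite statesS states_after_break // /alt.
    by case: (odd n); case: (c _) => //= /andP[]; lra.
  apply/funext => k; rewrite /broken; case: (ltngtP k n) => hk; [exact: h1 | | by rewrite hk].
  by apply: (h3 k.+1); lia.
case=> [-> n|[m ->] n]; first by rewrite states_alt //; case: odd; apply/andP; split; lra.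
have b1 k : (k < m)%N -> broken m k = alt k by rewrite /broken => ->.
have b2 : broken m m = odd m by rewrite /broken ltnn eqxx.
case: (leqP n m) => nm.
  rewrite states_alt => [|k kn]; last by apply: b1; lia.
  by case: odd; apply/andP; split; lra.
rewrite -(subnKC nm) addSnnS states_after_break // => [|j hj].
  by case: odd; apply/andP; split; lra.
by rewrite /broken; case: ltngtP hj; lia.
Qed.

End Golden.

(** * Free binary choices along an orbit below the golden ratio *)

Section Branching.
Variable (R : realType) (p : R).
Hypothesis p_gt1 : 1 < p.
Hypothesis p_small : p ^+ 2 < p + 1.
Local Notation g := ((p - 1)^-1).
Let p0 : 0 < p. Proof. exact: lt_trans ltr01 p_gt1. Qed.
Let pg : p * g = g + 1.
Proof.
have pp : 0 < p - 1 by rewrite subr_gt0.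
by apply: (mulIf (lt0r_neq0 pp)); rewrite -mulrA mulrDl mulVf ?gt_eqF // mulr1 mul1r addrC subrK.
Qed.
(** Equivalent to [p^2 < p + 1]. It separates the two end zones of length [1/p] and prevents a
    direct passage from one to the other. *)
Let g_big : 1 + p^-1 < g.
Proof.
have P1 := p_gt1; have E := p_small; have pp : 0 < p - 1 by rewrite subr_gt0.
rewrite -(ltr_pM2r pp) mulVf ?gt_eqF // -(ltr_pM2l p0) mulr1.
have -> : p * ((1 + p^-1) * (p - 1)) = (p + p * p^-1) * (p - 1) by ring.
by rewrite divff ?gt_eqF //; lra.
Qed.
Let pV_lt1 : p^-1 < 1. Proof. by rewrite invf_lt1. Qed.
Let pV_gt0 : 0 < p^-1. Proof. by rewrite invr_gt0. Qed.

(** Within [1/p] of an end of the interval only one digit keeps an inner state inner; elsewhere both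
    do, and the bit [b] decides. *)
Definition choice_digit (r : R) (b : bool) :=
  if r <= p^-1 then false else if g - r <= p^-1 then true else b.

Definition is_switch (r : R) := (p^-1 < r) && (p^-1 < g - r).

Lemma choice_digit_switch r b : is_switch r -> choice_digit r b = b.
Proof. by rewrite /choice_digit => /andP[h1 h2]; rewrite !leNgt h1 h2. Qed.

Lemma choice_digit_inner r b : inner p r -> inner p (p * r - (choice_digit r b)%:R).
Proof.
move=> /andP[r0 r1]; have G := g_big; have E := pg; have V0 := pV_gt0; have V1 := pV_lt1.
have low x : x <= p^-1 -> p * x <= 1.
  by move=> hx; rewrite -[1](divff (lt0r_neq0 p0)) ler_pM2l.
have high x : p^-1 < x -> 1 < p * x.
  by move=> hx; rewrite -[ltLHS](divff (lt0r_neq0 p0)) ltr_pM2l.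
have pr : 0 < p * r by rewrite mulr_gt0.
have pgr : 0 < p * (g - r) by rewrite mulr_gt0 ?subr_gt0.
rewrite mulrBr E in pgr high; rewrite /choice_digit.
case: (lerP r p^-1) => h1; first by have := low _ h1; rewrite subr0 /inner pr /=; lra.
have := high _ h1.
case: (lerP (g - r) p^-1) => h2; first by have := low _ h2; rewrite mulrBr E /inner /=; lra.
have := high _ h2; rewrite mulrBr E /inner.
by case: b => /=; rewrite ?subr0; lra.
Qed.

Section Run.
Variable (x : R) (b : nat -> bool).
Hypothesis x_inner : inner p x.

(* Current remainder, together with the number of bits of [b] already used. *)
Fixpoint run n : R * nat := if n is n.+1 then
    (p * (run n).1 - (choice_digit (run n).1 (b (run n).2))%:R,
     ((run n).2 + is_switch (run n).1)%N)
  else (x, 0%N).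

Definition run_digit n := choice_digit (run n).1 (b (run n).2).

Lemma states_run n : states p x run_digit n = (run n).1.
Proof. by elim: n => [//|n IH]; rewrite statesS IH. Qed.

Lemma run_inner n : inner p (run n).1.
Proof. by elim: n => [//|n IH] /=; apply: choice_digit_inner. Qed.

(** Without switches the orbit stays in one end zone, where its distance to that end is multiplied
    by [p] at each step and outgrows [1/p]. *)
Lemma run_switches n : exists2 m, (n <= m)%N & is_switch (run m).1.
Proof.
apply: contrapT => no.
have G := g_big; have E := pg; have V0 := pV_gt0; have V1 := pV_lt1.
have nsw k : ((run (n + k)).1 <= p^-1) || (g - (run (n + k)).1 <= p^-1).
  rewrite !leNgt -negb_and; apply/negP => h; apply: no.
  by exists (n + k)%N => //; rewrite leq_addr.
have low y : y <= p^-1 -> p * y <= 1.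
  by move=> hy; rewrite -[1](divff (lt0r_neq0 p0)) ler_pM2l.
have /andP[i0 i1] := run_inner n.
have := nsw 0%N; rewrite addn0 => /orP[] h.
  have st k : (run (n + k)).1 = p ^+ k * (run n).1 /\ (run (n + k)).1 <= p^-1.
    elim: k => [|k [IH1 IH2]]; first by rewrite addn0 mul1r.
    have e : (run (n + k.+1)).1 = p * (run (n + k)).1.
      by rewrite addnS /= /choice_digit IH2 subr0.
    split; first by rewrite e IH1 exprS mulrA.
    have := low _ IH2; rewrite -e; case/orP: (nsw k.+1); lra.
  have [k hk] := pow_unbounded (p^-1 / (run n).1) p_gt1.
  have [e1] := st k; rewrite e1 leNgt -ltr_pdivrMr //.
  by rewrite hk.
have st k : g - (run (n + k)).1 = p ^+ k * (g - (run n).1) /\ g - (run (n + k)).1 <= p^-1.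
  elim: k => [|k [IH1 IH2]]; first by rewrite addn0 mul1r.
  have e : g - (run (n + k.+1)).1 = p * (g - (run (n + k)).1).
    rewrite addnS /= /choice_digit IH2 ifF; first by rewrite /= mulrBr E; lra.
    by apply/negbTE; rewrite -ltNge; lra.
  split; first by rewrite e IH1 exprS mulrA.
  have := low _ IH2; rewrite -e; case/orP: (nsw k.+1); lra.
have i2 : 0 < g - (run n).1 by rewrite subr_gt0.
have [k hk] := pow_unbounded (p^-1 / (g - (run n).1)) p_gt1.
have [e1] := st k; rewrite e1 leNgt -ltr_pdivrMr //.
by rewrite hk.
Qed.

Lemma run_next_switch n : exists m, is_switch (run m).1 /\ (run m).2 = (run n).2.
Proof.
have ex : exists k, is_switch (run (n + k)).1.
  by have [m nm h] := run_switches n; exists (m - n)%N; rewrite subnKC.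
case: (ex_minnP ex) => k hk mk; exists (n + k)%N; split=> //.
have : forall i, (i <= k)%N -> (run (n + i)).2 = (run n).2; last exact.
elim=> [|i IH] ik; first by rewrite addn0.
rewrite addnS /= IH; last by lia.
case: (boolP (is_switch (run (n + i)).1)) => [/mk|_]; [lia | by rewrite addn0].
Qed.

Lemma run_all_bits j : exists n, is_switch (run n).1 /\ (run n).2 = j.
Proof.
elim: j => [|j [n [hn nj]]]; first by have := run_next_switch 0.
have [m [hm e]] := run_next_switch n.+1; exists m; split=> //.
by rewrite e /= hn nj addn1.
Qed.

End Run.

(** Equal digits give equal states and equal counters, since consuming a bit depends on the state
    alone. When bit [j] is consumed, the digit is that bit. *)
Lemma run_digit_inj x : inner p x -> injective (run_digit x).
Proof.
move=> ix b b' e.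
have er n : run x b n = run x b' n.
  elim: n => [//|n IH] /=; rewrite -IH; congr (_ - (nat_of_bool _)%:R, _).
  by have := congr1 (fun f => f n) e; rewrite /run_digit -IH.
apply/funext => j; have [n [hn nj]] := run_all_bits b ix j.
have := congr1 (fun f => f n) e; rewrite /run_digit -er.
by rewrite !choice_digit_switch // nj.
Qed.

End Branching.

(** * Expansions, negative bases and cardinalities *)

Section Expansions.
Variable (R : realType) (p : R).
Hypothesis p_gt1 : 1 < p.
Local Notation g := ((p - 1)^-1).
Local Notation S c := (series (fun k => (c k : bool)%:R * p ^- k.+1)).
Let p0 : 0 < p. Proof. exact: lt_trans ltr01 p_gt1. Qed.

Lemma statesE x (c : nat -> bool) n : states p x c n = p ^+ n * (x - S c n).
Proof.
elim: n => [|n IH]; first by rewrite /series /= big_geq // subr0 mul1r.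
rewrite statesS IH seriesSr opprD addrA [RHS]mulrBr exprS; congr (_ - _).
  by rewrite mulrA.
by rewrite mulrCA -exprS divff ?mulr1 // expf_neq0 // gt_eqF.
Qed.

Lemma bounded_states_expansion x c :
  (forall n, 0 <= states p x c n <= g) -> expansions p x c.
Proof.
move=> h; have gp : 0 < g by rewrite invr_gt0 subr_gt0.
apply/cvgrPdist_lt => e e0.
have [N hN] := pow_unbounded (g / e) p_gt1.
exists N => // n /= Nn.
have pn : 0 < p ^+ n by rewrite exprn_gt0.
rewrite -(ltr_pM2l pn) -[X in X * _](gtr0_norm pn) -normrM -statesE.
have /andP[h0 h1] := h n; rewrite ger0_norm //; apply: le_lt_trans h1 _.
rewrite -ltr_pdivrMr //; apply: lt_le_trans hN _.
by rewrite ler_eXn2l.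
Qed.

(** From a state outside the interval the distance to it grows at least like [p^k], whereas
    convergence makes the states [o(p^n)] by [statesE]. *)
Lemma expansion_bounded_states x c n : expansions p x c -> 0 <= states p x c n <= g.
Proof.
move=> /cvgrPdist_lt h; have P1 := p_gt1.
have pn j : 0 < p ^+ j by rewrite exprn_gt0.
have far (d : R) : 0 < d -> (forall k, d * p ^+ k <= `|states p x c (n + k)|) -> False.
  move=> d0 hd; have [N _ hN] := h (d / p ^+ n) (divr_gt0 d0 (pn n)).
  have := hN (n + N)%N (leq_addl _ _) => /=.
  rewrite -(ltr_pM2l (pn (n + N)%N)) -[X in X * _](gtr0_norm (pn (n + N)%N)) -normrM -statesE.
  rewrite exprD [X in _ < X](_ : _ = d * p ^+ N) ?ltNge ?hd //.
  by field; rewrite gt_eqF.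
have pp : 0 < p - 1 by rewrite subr_gt0.
have pg : p * g = g + 1.
  by apply: (mulIf (lt0r_neq0 pp)); rewrite -mulrA mulrDl mulVf ?gt_eqF // mulr1 mul1r addrC subrK.
have gp : 0 < g by rewrite invr_gt0.
apply/andP; split; rewrite leNgt; apply/negP => lt.
  apply: (far (- states p x c n)); first by rewrite oppr_gt0.
  move=> k; suff hk : states p x c (n + k) <= states p x c n * p ^+ k.
    by rewrite mulNr -normrN; apply: le_trans (ler_norm _); rewrite lerN2.
  elim: k => [|k IH]; first by rewrite addn0 mulr1.
  rewrite addnS statesS exprS mulrCA; apply: (@le_trans _ _ (p * states p x c (n + k))).
    by rewrite gerBl.
  by rewrite ler_pM2l.
apply: (far (states p x c n - g)); first by rewrite subr_gt0.
move=> k; suff hk : (states p x c n - g) * p ^+ k <= states p x c (n + k) - g.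
  by apply: le_trans hk _; apply: le_trans (ler_norm _); rewrite gerBl ltW.
elim: k => [|k IH]; first by rewrite addn0 mulr1.
rewrite addnS statesS exprS mulrCA; apply: (@le_trans _ _ (p * (states p x c (n + k) - g))).
  by rewrite ler_pM2l.
by rewrite mulrBr pg; case: (c _) => /=; lra.
Qed.

End Expansions.

(** * Passing between the bases [-p] and [p] *)

Section Flip.
Variable (R : realType) (p : R).
Hypothesis p_gt1 : 1 < p.
Let p0 : 0 < p. Proof. exact: lt_trans ltr01 p_gt1. Qed.

(** Digit [k] has weight [(-p)^-(k+1)], so the even indices are those of negative weight. *)
Definition flip (c : nat -> bool) k := c k (+) ~~ odd k.

Lemma flipK : involutive flip.
Proof. by move=> c; apply/funext => k; rewrite /flip -addbA addbb addbF. Qed.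

(** The sum of [p^-(k+1)] over even [k]. *)
Definition shift := p / (p ^+ 2 - 1).

Lemma shift_expansion : expansions p shift (fun k => ~~ odd k).
Proof.
have P1 := p_gt1; have pp : 0 < p - 1 by rewrite subr_gt0.
have p2 : 0 < p ^+ 2 - 1 by rewrite subr_gt0 exprn_egt1.
have st n : states p shift (fun k => ~~ odd k) n = if odd n then (p ^+ 2 - 1)^-1 else shift.
  elim: n => [//|n IH]; rewrite statesS IH /shift /=; case: (odd n) => /=.
    by rewrite subr0.
  by field; rewrite gt_eqF.
apply: bounded_states_expansion => // n; rewrite st.
have e : (p - 1)^-1 = (p + 1) * (p ^+ 2 - 1)^-1.
  by field; rewrite !gt_eqF //; lra.
have i0 : 0 < (p ^+ 2 - 1)^-1 by rewrite invr_gt0.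
case: odd; rewrite ?e /shift; apply/andP; split; rewrite ?mulr_ge0 ?(ltW i0) ?(ltW p0) //.
  by rewrite ler_peMl ?(ltW i0) //; lra.
by rewrite ler_pM2r //; lra.
Qed.

Lemma expansions_flip x c : expansions (- p) x c <-> expansions p (x + shift) (flip c).
Proof.
pose A := series (fun k => (c k)%:R * (- p) ^- k.+1).
pose B := series (fun k => (flip c k)%:R * p ^- k.+1).
pose D := series (fun k => (~~ odd k)%:R * p ^- k.+1).
have E : B = A + D.
  apply/funext => n; rewrite /B /A /D /series /= fctE /= -big_split /=; apply: eq_bigr => k _.
  have sg : (-1) ^+ k.+1 = (if odd k then 1 else -1) :> R.
    by rewrite -signr_odd /=; case: (odd k).
  rewrite exprNn invfM invr_sign mulrA -mulrDl sg /flip; congr (_ * _).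
  by case: (c k); case: (odd k) => /=; ring.
have cD : D @ \oo --> shift by exact: shift_expansion.
split=> h.
  by rewrite /expansions /= -/B E; apply: cvgD.
have EA : A = B - D by rewrite E addrK.
rewrite /expansions /= -/A EA -[x](addrK shift).
exact: cvgB.
Qed.

Lemma interior_inner x : interior (J (- p)) x -> inner p (x + shift).
Proof.
move=> /nbhs_ballP[e /= e0 h].
have sub y : `|x - y| < e -> 0 <= y + shift <= (p - 1)^-1.
  move=> /h [c] /expansions_flip /(expansion_bounded_states p_gt1 0).
  by rewrite states0.
have h1 := sub (x - e / 2); have h2 := sub (x + e / 2).
have k1 : `|x - (x - e / 2)| < e.
  by rewrite opprB addrCA subrr addr0 gtr0_norm; lra.
have k2 : `|x - (x + e / 2)| < e.
  by rewrite opprD addrA subrr add0r normrN gtr0_norm; lra.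
have /andP[a1 a2] := h1 k1; have /andP[b1 b2] := h2 k2.
by apply/andP; split; lra.
Qed.

End Flip.

Lemma universal_flip c : universal c -> universal (flip c).
Proof.
move=> u w; pose n := size w.
(* One of the two halves of this block has the right parity, wherever it occurs. *)
pose v := mkseq (fun i => if (i < n)%N then nth false w i (+) ~~ odd i
                          else nth false w (i - n) (+) odd i) (n + n).
have [m] := u v; rewrite size_mkseq => hm.
have cm i : (i < n + n)%N -> c (m + i)%N = nth false v i.
  by move=> hi; rewrite -hm nth_mkseq.
exists (if odd m then (m + n)%N else m).
apply: (@eq_from_nth _ false); first by rewrite size_mkseq.
move=> i; rewrite size_mkseq => hi; rewrite nth_mkseq // /flip.
case: ifP => om.
  rewrite -addnA cm ?ltn_add2l // nth_mkseq ?ltn_add2l // ltnNge leq_addr /= addKn.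
  by rewrite !oddD om; case: (nth _ _ _); case: (odd n); case: (odd i).
rewrite cm; last by rewrite /n; lia.
rewrite nth_mkseq; last by rewrite /n; lia.
by rewrite hi oddD om; case: (nth _ _ _); case: (odd i).
Qed.

(** In base 3 with digits 0 and 1 the states stay in [[0, 1/2]], which admits at most one digit at
    each step, so distinct sequences have distinct sums. *)
Lemma card_bitstream_le_real (R : realType) : ([set: nat -> bool] #<= [set: R])%card.
Proof.
have three : 1 < 3 :> R by lra.
pose S (b : nat -> bool) := series (fun k => (b k)%:R * (3 : R) ^- k.+1).
have cv b : cvgn (S b).
  apply: nondecreasing_is_cvgn.
    apply/nondecreasing_seqP => n; rewrite /S seriesSr lerDl mulr_ge0 //.
  exists (2^-1) => _ [n _ <-].
  suff : S b n <= 2^-1 - 2^-1 * 3 ^- n.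
    move/le_trans; apply; rewrite gerBl mulr_ge0 // invr_ge0 exprn_ge0 //.
  elim: n => [|n IH]; first by rewrite /S /series /= big_geq // expr0 invr1 mulr1 subrr.
  rewrite /S seriesSr -/(S b n).
  have z : 0 <= (3 : R) ^- n by rewrite invr_ge0 exprn_ge0.
  have -> : (3 : R) ^- n.+1 = 3^-1 * 3 ^- n by rewrite exprS invfM.
  move: IH z; move: (3 ^- n) (S b n) => t s; case: (b n) => /=; lra.
have inj : injective (fun b => limn (S b)).
  move=> b b' e.
  have eb : expansions 3 (limn (S b)) b by exact: cv.
  have eb' : expansions 3 (limn (S b)) b' by rewrite e; exact: cv.
  have bd c n : expansions 3 (limn (S b)) c -> 0 <= states 3 (limn (S b)) c n <= 2^-1.
    have -> : (2 : R)^-1 = (3 - 1)^-1 by congr (_^-1); lra.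
    exact: expansion_bounded_states.
  have step n : states 3 (limn (S b)) b n = states 3 (limn (S b)) b' n -> b n = b' n.
    move=> en; have := bd _ n.+1 eb; have := bd _ n.+1 eb'; rewrite !statesS en.
    by case: (b n); case: (b' n) => //= /andP[h1 h2] /andP[h3 h4]; exfalso; lra.
  have st n : states 3 (limn (S b)) b n = states 3 (limn (S b)) b' n.
    by elim: n => [//|n IH]; rewrite !statesS (step n IH) IH.
  by apply/funext => n; apply: step.
have /card_eqPle[_ h] := @inj_card_eq _ _ [set: nat -> bool] _ (in2W inj).
by apply: card_le_trans h _; apply: subset_card_le.
Qed.

(** A real number is determined by the set of rationals below it. *)
Lemma card_real_le_bitstream (R : realType) : ([set: R] #<= [set: nat -> bool])%card.
Proof.
pose f (r : R) n := if unpickle n is Some q then (ratr q : R) < r else false.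
have inj : injective f.
  have lt r r' : r < r' -> f r <> f r'.
    move=> /rat_in_itvoo[q]; rewrite in_itv /= => /andP[h1 h2] e.
    have := congr1 (fun h => h (pickle q)) e; rewrite /f pickleK h2.
    by rewrite ltNge (ltW h1).
  move=> r r' e; have [/lt|/lt|//] := ltgtP r r'; first by rewrite e.
  by move/(_ (esym e)).
have /card_eqPle[_ h] := @inj_card_eq _ _ [set: R] _ (in2W inj).
by apply: card_le_trans h _; apply: subset_card_le.
Qed.

Theorem theorem3p2 (R : realType) (q : R) (hq : q < -1) :
  [/\ q = - ((1 + Num.sqrt 5) / 2) -> (expansions q 0 #= [set: nat])%card,
      - ((1 + Num.sqrt 5) / 2) < q ->
        forall x : R, interior (J q) x -> (expansions q x #= [set: R])%card &
      - (2 `^ 4^-1) < q -> ~ second_pisot (q ^+ 2) ->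
        forall x : R, interior (J q) x ->
          exists2 c, expansions q x c & universal c].
Proof.
have s5 : Num.sqrt (5 : R) ^+ 2 = 5 by rewrite sqr_sqrtr.
have s50 : 0 <= Num.sqrt (5 : R) by rewrite sqrtr_ge0.
pose p := - q; have qE : q = - p by rewrite opprK.
have p1 : 1 < p by rewrite ltrNr.
have p0 : 0 < p by lra.
split=> [hg|hg x hx|hg _ x hx].
(* At the golden ratio the translation is 1 and the interval is [[0, p]], so the expansions of 0
   correspond to the orbits of 1 in [golden_expansions]. *)
- have gold : p ^+ 2 = p + 1 by rewrite /p hg opprK; lra.
  have sh : shift p = 1 by rewrite /shift gold addrK divff // gt_eqF.
  have gE : (p - 1)^-1 = p.
    apply: (mulIf (lt0r_neq0 (_ : 0 < p - 1))); first by rewrite subr_gt0.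
    by rewrite mulVf ?mulrBr -?expr2 ?gold; [ring | rewrite gt_eqF ?subr_gt0].
  have exE c : expansions q 0 c <-> flip c = (fun k => ~~ odd k) \/ exists n, flip c = broken n.
    rewrite qE (expansions_flip p1) sh add0r -(golden_expansions p1 gold); split.
      by move=> h n; have := expansion_bounded_states p1 n h; rewrite gE.
    by move=> h; apply: bounded_states_expansion => // n; rewrite gE.
  pose f n := flip (if n is n.+1 then broken n else fun k => ~~ odd k).
  have -> : expansions q 0 = f @` [set: nat].
    apply/seteqP; split=> c.
      case/exE => [e|[n e]]; first by exists 0%N => //; rewrite /f -e flipK.
      by exists n.+1 => //; rewrite /f -e flipK.
    case=> n _ <-; apply/exE; rewrite /f flipK; case: n => [|n]; [by left | by right; exists n].
  (* The position of the first break recovers the index. *)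
  apply: inj_card_eq; apply: in2W => m n /(can_inj flipK).
  have b k : broken k k = odd k by rewrite /broken ltnn eqxx.
  have b' k l : (k < l)%N -> broken l k = ~~ odd k by rewrite /broken => ->.
  case: m n => [|m] [|n] // e.
  + by have := congr1 (fun h => h n) e; rewrite b; case: odd.
  + by have := congr1 (fun h => h m) e; rewrite b; case: odd.
  congr _.+1; apply/eqP; apply/negPn/negP; rewrite neq_ltn => /orP[] mn.
    by have := congr1 (fun h => h m) e; rewrite b b' //; case: odd.
  by have := congr1 (fun h => h n) e; rewrite b b' //; case: odd.
- have small : p ^+ 2 < p + 1.
    have : p < (1 + Num.sqrt 5) / 2 by rewrite ltrNl.
    by nra.
  rewrite qE in hx *; have ix := interior_inner p1 hx.
  have inn n y c : inner p (states p y c n) -> 0 <= states p y c n <= (p - 1)^-1.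
    by move=> /andP[h1 h2]; rewrite !ltW.
  apply/card_eqPle; split.
    by apply: card_le_trans (card_bitstream_le_real R); apply: subset_card_le.
  apply: card_le_trans (card_real_le_bitstream R) _.
  (* Distinct choice sequences [b] yield distinct expansions, so the expansions are at least as many
     as the bit streams. *)
  pose f b := flip (run_digit p (x + shift p) b).
  have inj : injective f by move=> b b' /(can_inj flipK); apply: run_digit_inj.
  have /card_eqPle[_ h] := @inj_card_eq _ _ [set: nat -> bool] _ (in2W inj).
  apply: card_le_trans h _; apply: subset_card_le => _ [b _ <-].
  apply/(expansions_flip p1); rewrite /f flipK.
  apply: bounded_states_expansion => // n; apply: inn.
  by rewrite states_run; apply: run_inner.
- have p4 : p ^+ 4 < 2.
    have h : p < 2 `^ 4^-1 by rewrite ltrNl.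
    have -> : (2 : R) = (2 `^ 4^-1) ^+ 4.
      by rewrite -powR_mulrn ?powR_ge0 // -powRrM mulVf ?powRr1.
    by rewrite ltrXn2r // ?nnegrE ?powR_ge0 // ltW.
  rewrite qE in hx *; have ix := interior_inner p1 hx.
  have [c [ic uc]] := universal_states p1 p4 ix.
  exists (flip c); last exact: universal_flip.
  apply/(expansions_flip p1); rewrite flipK.
  by apply: bounded_states_expansion => // n; have /andP[h1 h2] := ic n; rewrite !ltW.
Qed.
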